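(* Assume that $n_b/n\to\theta$ as $n\to\infty$ for some $\theta\in(0,1)$. Denote $\gamma_\theta=\sqrt{\frac{1-\theta}{\theta}}$. Let $(\kappa_n)_{n\ge 1}$ be a sequence of positive integers that tends to infinity and satisfies $\kappa_n/n\to 0$ as $n\to\infty$. Then $$\rho^{(n)}_{\kappa_n}\xrightarrow{n\to\infty}\frac{1}{1+\gamma_\theta}=\frac{\sqrt\theta}{\sqrt\theta+\sqrt{1-\theta}}\quad\text{in probability.}$$
   Context: For each $n$, let $n_b=n_b(n)$ and $n_w=n_w(n)$ be natural numbers with $n_b+n_w=n$. Let $K_{n_b,n_w}$ be the complete bipartite graph on the vertex set $V_n=V^b_n\cup V^w_n$ (disjoint union), $|V^b_n|=n_b$ (black vertices), $|V^w_n|=n_w$ (white vertices), with edge set $E_n=\{\{v,w\}:v\in V^b_n,w\in V^w_n\}$. Let $\{U_e:e\in E_n\}$ be i.i.d. uniform random variables on $(0,1)$ (a.s. all distinct). Prim's Algorithm: $\sigma(1)$ is a uniform element of $V_n$ (independent of the weights). For $2\le k\le n$, given $\Sigma(k-1)=\{\sigma(i):1\le i\le k-1\}$, let $e_{k-1}$ be the a.s. unique edge minimizing $U_e$ among all edges $e=\{v,v'\}\in E_n$ with $v\in\Sigma(k-1)$, $v'\in V_n\setminus\Sigma(k-1)$; let $\sigma(k)$ be the endpoint of $e_{k-1}$ not in $\Sigma(k-1)$. For $1\le k\le n$, $\Sigma(k)=\{\sigma(i):1\le i\le k\}$, $\Sigma^b(k)=\Sigma(k)\cap V^b_n$, and $\rho^{(n)}_k=|\Sigma^b(k)|/k$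 is the proportion of black vertices among the first $k$ vertices. *)

(* Defs.v *)
From mathcomp Require Import all_boot all_order all_algebra.
From mathcomp Require Import all_classical all_reals all_analysis.

Set Implicit Arguments.
Unset Strict Implicit.
Unset Printing Implicit Defensive.
Import Order.TTheory GRing.Theory Num.Theory.
Import numFieldNormedType.Exports.

Local Open Scope classical_set_scope.
Local Open Scope ring_scope.

(* Vertices of K_{nb,nw}: [inl] is black, [inr] is white.  As every edge joins
   a black vertex to a white one, {v, w} is encoded by the pair (v, w). *)
Notation vertex nb nw := ('I_nb + 'I_nw)%type.
Notation edge nb nw := ('I_nb * 'I_nw)%type.

Section Prim.
Context {R : realType} {nb nw : nat}.
Implicit Types (u : edge nb nw -> R) (S : {set vertex nb nw}).
Implicit Types (x : vertex nb nw) (k : nat).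

Definition crossing S (e : edge nb nw) : bool :=
  (inl e.1 \in S) (+) (inr e.2 \in S).

(* Unique when the weights are pairwise distinct; [None] exactly when no edge
   leaves S. *)
Definition min_edge u S : option (edge nb nw) :=
  [pick e | crossing S e & [forall f, crossing S f ==> (u e <= u f)]].

Definition outer_endpoint S (e : edge nb nw) : vertex nb nw :=
  if inl e.1 \in S then inr e.2 else inl e.1.

(* The sequence [:: sigma(1); ...; sigma(k)] of the first k vertices found by
   Prim's algorithm with weights u and sigma(1) = x.  It stops growing only if
   no crossing edge is left, e.g. for k > nb + nw. *)
Fixpoint prim u x k : seq (vertex nb nw) :=
  match k with
  | 0 => [::]
  | 1 => [:: x]
  | (_.+1 as k').+1 =>
      let s := prim u x k' in
      let S := [set v in s] in
      if min_edge u S is Some e then rcons s (outer_endpoint S e) else s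
  end.

Definition Sigma u x k : {set vertex nb nw} := [set v in prim u x k].

Definition Sigma_black u x k : {set vertex nb nw} :=
  Sigma u x k :&: [set inl b | b : 'I_nb].

Definition rho u x k : R := #|Sigma_black u x k|%:R / k%:R.

End Prim.

Section Probability.
Context {R : realType} {d : measure_display} {T : measurableType d}.
Variable P : probability T R.

Definition mutually_independent (I : finType) (X : I -> T -> R) : Prop :=
  forall (J : {set I}) (A : I -> set R), (forall i, measurable (A i)) ->
    P (\bigcap_(i in [set` J]) (X i @^-1` A i)) =
    (\prod_(i in J) P (X i @^-1` A i))%E.

Definition iid_uniform (I : finType) (X : I -> {RV P >-> R}) : Prop :=
  (forall i (A : set R), measurable A ->
     distribution P (X i) A = uniform_prob (@ltr01 R) A) /\
  mutually_independent (fun i => X i : T -> R).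

Definition sigma_algebra_of (I : Type) (X : I -> T -> R) : set (set T) :=
  <<s [set B | exists i, exists2 A : set R, measurable A & B = X i @^-1` A] >>.

Definition uniform_element (V : finType) (Y : T -> V) : Prop :=
  forall v : V, measurable (Y @^-1` [set v]) /\
    P (Y @^-1` [set v]) = (#|V|%:R^-1)%:E.

Definition independent_of (V : finType) (Y : T -> V)
    (I : Type) (X : I -> T -> R) : Prop :=
  forall (A : set V) (B : set T), sigma_algebra_of X B ->
    P (Y @^-1` A `&` B) = (P (Y @^-1` A) * P B)%E.

End Probability.

(* The n-th variable lives on its own probability space. *)
Definition cvg_in_probability {R : realType} {d : nat -> measure_display}
    {T : forall n, measurableType (d n)} (P : forall n, probability (T n) R)
    (Y : forall n, T n -> R) (c : R) : Prop :=
  forall eps : R, 0 < eps ->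
    P n [set w | eps < `|Y n w - c|] @[n --> \oo] --> 0%E.

Definition gamma {R : realType} (theta : R) : R :=
  Num.sqrt ((1 - theta) / theta).

(* Main.v *)
(* Fix p slightly above the critical value 1 / sqrt(nb nw), so that a black
   (white) vertex has about (1 + e) g, resp. (1 + e) / g, edges of weight at
   most p, where g = sqrt(nw / nb).  Along Prim's algorithm let F(m) count the
   pairs of a reached vertex and a neighbour of the opposite colour first found
   from it through an edge of weight at most p.  An edge is independent of all
   that happens before it is uncovered, so F minus its compensator has
   uncorrelated increments, and Chebyshev's inequality gives, up to o(kappa),
     F_black(m) = (1 + e) g #black(m),  F_white(m) = (1 + e) / g #white(m)
   for m = kappa and on a finite grid of times.  If no edge of weight at most p
   leaves Sigma(m), all the vertices found have been reached:
   F_black(m) <= #white(m) and F_white(m) <= #black(m).  As e > 0 this forces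
   m = o(kappa).  After that time only edges of weight at most p are used, so
   #white(kappa) <= F_black(kappa) + o(kappa) and symmetrically, whence
   #white / #black is within O(e) of g. *)
Require Import Defs.
From mathcomp Require Import all_boot all_order all_algebra.
From mathcomp Require Import all_classical all_reals all_analysis.
From mathcomp Require Import ring lra zify.
Import Order.TTheory GRing.Theory Num.Theory.
Import numFieldNormedType.Exports.
Local Open Scope ring_scope.

Set Implicit Arguments.
Unset Strict Implicit.
Unset Printing Implicit Defensive.

(** * Prim's algorithm: which weights matter *)

(** Colours are Booleans throughout, [true] for black, so that a statement and its mirror image
    under exchange of the colours are one lemma. *)
Definition colour_size (nb nw : nat) (c : bool) : nat := if c then nb else nw.

Section PrimCombinatorics.
Context {R : realType} {nb nw : nat}.
Implicit Types (u : edge nb nw -> R) (S : {set vertex nb nw}).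
Implicit Types (x v : vertex nb nw) (s q : seq (vertex nb nw)) (k m : nat).
Implicit Types (c : bool) (e f : edge nb nw) (A : pred (edge nb nw)).

Definition black v : bool := if v is inl _ then true else false.
Definition endpoint c e : vertex nb nw := if c then inl e.1 else inr e.2.

Lemma black_endpoint c e : black (endpoint c e) = c.
Proof. by case: c. Qed.

Lemma endpoint_inj c e f : endpoint c e = endpoint c f -> endpoint (~~ c) e = endpoint (~~ c) f -> e = f.
Proof.
case: e f => [e1 e2] [f1 f2].
by case: c => /= -[->] [->].
Qed.

Lemma join_vertices c v v' : black v = c -> black v' = ~~ c ->
  exists2 e, endpoint c e = v & endpoint (~~ c) e = v'.
Proof.
case: c v v' => [] [b|w] [b'|w'] //= _ _.
- by exists (b, w').
- by exists (b', w).
Qed.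

Lemma card_black c : #|[set v : vertex nb nw | black v == c]| = colour_size nb nw c.
Proof.
case: c => /=.
- rewrite -[RHS]card_ord -(card_imset _ (@inl_inj 'I_nb 'I_nw)).
  apply: eq_card => -[b|w]; rewrite !inE /=.
  + by rewrite (mem_imset _ _ inl_inj).
  + by apply/esym/imsetP => -[].
- rewrite -[RHS]card_ord -(card_imset _ (@inr_inj 'I_nb 'I_nw)).
  apply: eq_card => -[b|w]; rewrite !inE /=.
  + by apply/esym/imsetP => -[].
  + by rewrite (mem_imset _ _ inr_inj).
Qed.

Lemma crossingE c S e : crossing S e = (endpoint c e \in S) (+) (endpoint (~~ c) e \in S).
Proof. by case: c; rewrite /crossing //= addbC. Qed.

Lemma outer_endpointP S e : crossing S e ->
  exists c, [/\ endpoint c e \in S, endpoint (~~ c) e \notin S &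
                outer_endpoint S e = endpoint (~~ c) e].
Proof.
rewrite (crossingE true) /= /outer_endpoint => cr.
case: ifP cr => [bS /= wS|bS wS]; first by exists true.
by exists false; split => //=; rewrite bS.
Qed.

Lemma min_edge_crossing u S e : min_edge u S = Some e ->
  crossing S e /\ forall f, crossing S f -> u e <= u f.
Proof.
rewrite /min_edge; case: pickP => // e' /andP[cre /forallP mine] [<-].
by split=> // f; apply/implyP.
Qed.

Lemma eq_min_edge u u' S :
  (forall f g, crossing S f -> crossing S g -> (u f <= u g) = (u' f <= u' g)) ->
  min_edge u S = min_edge u' S.
Proof.
move=> uu'; apply: eq_pick => e /=; case cre: (crossing S e) => //=.
apply: eq_forallb => f; case crf: (crossing S f) => //=.
exact: uu'.
Qed.

Lemma primSS u x k : prim u x k.+2 =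
  if min_edge u (Sigma u x k.+1) is Some e
  then rcons (prim u x k.+1) (outer_endpoint (Sigma u x k.+1) e)
  else prim u x k.+1.
Proof. by []. Qed.

Lemma prim_prefixS u x k : prefix (prim u x k) (prim u x k.+1).
Proof.
case: k => // k; rewrite primSS; case: min_edge => [e|]; last exact: prefix_refl.
exact: prefix_rcons.
Qed.

Lemma prim_prefix u x k m : (k <= m)%N -> prefix (prim u x k) (prim u x m).
Proof.
move=> /subnK <-; elim: (m - k)%N => [|i IH]; first exact: prefix_refl.
exact: prefix_trans IH (prim_prefixS _ _ _).
Qed.

Lemma prim_uniq u x k : uniq (prim u x k).
Proof.
elim: k => // -[//|k] IH; rewrite primSS; case me: min_edge => [e|//].
have [/outer_endpointP[c [_ + ->]] _] := min_edge_crossing me.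
by rewrite inE rcons_uniq IH andbT.
Qed.

(** The graph is connected: fix one black and one white vertex. Either their edge crosses, or both
    lie on the same side of [S] and one of them is joined to whichever of [v], [v'] lies on the
    other side. *)
Lemma min_edge_some u S v v' : v \in S -> v' \notin S -> (0 < nb)%N -> (0 < nw)%N ->
  exists e, min_edge u S = Some e.
Proof.
move=> vS v'S nb0 nw0.
have [e cre] : exists e, crossing S e.
  pose b0 := Ordinal nb0; pose w0 := Ordinal nw0.
  pose t := (b0, w0) : edge nb nw.
  have [cr|] := boolP (crossing S t); first by exists t.
  rewrite /crossing /= => same.
  case bS: (inl b0 \in S) same.
  + case wS: (inr w0 \in S) => //= _.
    case: v' v'S => [b|w] nS.
    * by exists (b, w0); rewrite /crossing /= wS (negbTE nS).
    * by exists (b0, w); rewrite /crossing /= bS (negbTE nS).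
  + case wS: (inr w0 \in S) => //= _.
    case: v vS => [b|w] yS.
    * by exists (b, w0); rewrite /crossing /= wS yS.
    * by exists (b0, w); rewrite /crossing /= bS yS.
rewrite /min_edge; case: pickP => [e'|none]; first by exists e'.
case: (arg_minP u cre).
move=> e' cre' mine; have := none e'; rewrite /= cre' /= => /forallPn[f].
by rewrite negb_imply => /andP[/mine ->].
Qed.

Lemma size_prim u x k : (k <= nb + nw)%N -> (0 < nb)%N -> (0 < nw)%N ->
  size (prim u x k) = k.
Proof.
move=> + nb0 nw0; elim: k => // -[//|k] IH kn.
have szk := IH (ltnW kn); rewrite primSS.
have xS : x \in Sigma u x k.+1.
  by rewrite inE; apply: prefix1s; apply: (@prim_prefix u x 1).
have [v' v'S] : exists v', v' \notin Sigma u x k.+1.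
  apply/existsP; rewrite -negb_forall; apply: contraL kn => /forallP all.
  rewrite -leqNgt -szk -(card_uniqP (prim_uniq u x k.+1)).
  have -> : (nb + nw)%N = #|{: vertex nb nw}| by rewrite card_sum !card_ord.
  by apply: subset_leq_card; apply/fintype.subsetP => v _; have := all v; rewrite inE.
have [e ->] := min_edge_some u xS v'S nb0 nw0.
by rewrite size_rcons szk.
Qed.

(* Before an endpoint of e is reached, the edge e is never crossing, hence its
   weight has no influence. *)
Lemma prim_coupling u u' x e m :
  (forall f g, f != e -> g != e -> (u f <= u g) = (u' f <= u' g)) ->
  prim u x m = prim u' x m \/
  exists q v, [/\ forall c, endpoint c e \notin q, v = endpoint true e \/ v = endpoint false e,
    prefix (rcons q v) (prim u x m) & prefix (rcons q v) (prim u' x m)].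
Proof.
move=> uu'; elim: m => [|[|m] IH]; [by left|by left|].
case: IH => [eqs|[q [v [qe ve pu pu']]]]; last first.
  right; exists q, v; split=> //;
  [apply: prefix_trans pu _|apply: prefix_trans pu' _]; exact: prim_prefixS.
(* If the run has met an endpoint of [e], cut it at the first one: [q] is what precedes it.
   Otherwise [e] does not cross and both runs choose the same next edge. *)
have [has_e|] := boolP (has (fun v => [exists c, endpoint c e == v]) (prim u x m.+1)).
  right; set h := (fun v => _) in has_e; set s := prim u x m.+1 in has_e eqs.
  pose i := find h s.
  have si : (i < size s)%N by rewrite -has_find.
  exists (take i s), (nth x s i); split.
  - move=> c; apply/negP => /[dup] /nthP - /(_ x)[j].
    rewrite size_takel; last exact: ltnW.
    move=> ji; rewrite nth_take // => eqe _.
    have := before_find x ji; rewrite /h eqe => /existsP[].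
    by exists c.
  - have := nth_find x has_e; rewrite -/i => /existsP[[] /eqP <-]; by [left|right].
  - rewrite -take_nth //; apply: prefix_trans (prim_prefixS _ _ _).
    exact: prefix_take.
  - rewrite -take_nth // eqs; apply: prefix_trans (prim_prefixS _ _ _).
    exact: prefix_take.
move=> /hasPn no_e; left; rewrite !primSS /Sigma -eqs.
have -> : min_edge u' [set v in prim u x m.+1] = min_edge u [set v in prim u x m.+1].
  apply/esym/eq_min_edge => f g crf crg; apply: uu'; apply/eqP => efg.
  - move: crf; rewrite efg (crossingE true) !inE.
    case tS: (endpoint true e \in _) => /=; last move=> wS.
      by have /existsPn/(_ true) := no_e _ tS; rewrite eqxx.
    by have /existsPn/(_ false) := no_e _ wS; rewrite eqxx.
  - move: crg; rewrite efg (crossingE true) !inE.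
    case tS: (endpoint true e \in _) => /=; last move=> wS.
      by have /existsPn/(_ true) := no_e _ tS; rewrite eqxx.
    by have /existsPn/(_ false) := no_e _ wS; rewrite eqxx.
by case: min_edge.
Qed.

Lemma eq_prim u u' x m :
  (forall f g, (u f <= u g) = (u' f <= u' g)) -> prim u x m = prim u' x m.
Proof.
move=> uu'; elim: m => // -[//|m] IH; rewrite !primSS /Sigma -IH.
by rewrite (@eq_min_edge u u').
Qed.

(** The two runs can part only after the first endpoint of [e], and none lies in [q]. As [v] may
    itself be such an endpoint, the run is carried over up to the very moment when [e] is
    uncovered. *)
Lemma prim_prefix_coupling u u' x e m q v :
  (forall f g, f != e -> g != e -> (u f <= u g) = (u' f <= u' g)) ->
  (forall c, endpoint c e \notin q) ->
  prefix (rcons q v) (prim u x m) -> prefix (rcons q v) (prim u' x m).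
Proof.
move=> uu' qe pq; have [<- //|[q' [v' [_ ve pu pu']]]] := prim_coupling x m uu'.
have [le|lt] := leqP (size q) (size q').
  apply: prefix_trans pu'.
  move: pq pu; rewrite !prefixE !size_rcons => /eqP pq /eqP pu.
  by rewrite -[X in take _ X]pu take_takel // pq.
exfalso.
have : v' \in q.
  move: pq pu => /prefixP[t ->] /prefixP[t' e1].
  have : nth v' (rcons q v ++ t) (size q') = v'.
    by rewrite e1 nth_cat size_rcons ltnSn nth_rcons ltnn eqxx.
  rewrite nth_cat size_rcons ltnS (ltnW lt) nth_rcons lt => <-.
  exact: mem_nth.
by case: ve => ->; rewrite ?(negbTE (qe true)) ?(negbTE (qe false)).
Qed.

End PrimCombinatorics.

(** * Fresh edges and the counts derived from them *)

Section FreshEdges.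
Context {R : realType} {nb nw : nat}.
Implicit Types (u : edge nb nw -> R) (v : vertex nb nw).
Implicit Types (s r : seq (vertex nb nw)) (k m : nat).
Implicit Types (c : bool) (e f : edge nb nw) (A : pred (edge nb nw)).

(* With s a run of Prim's algorithm: when the endpoint of e of colour c is
   reached, the other endpoint is neither reached nor joined by an edge of A to
   an earlier vertex of colour c. *)
Definition fresh c A s e : bool :=
  let q := take (index (endpoint c e) s) s in
  [&& endpoint c e \in s, endpoint (~~ c) e \notin q &
      [forall f, (endpoint (~~ c) f == endpoint (~~ c) e) && (endpoint c f \in q) ==> ~~ A f]].

(** Exposed edges are the trials, found ones the successes: for [A] the edges of weight at most p,
    [#|found c A s|] is the F of the overview and p times [#|exposed c A s|] its compensator. *)
Definition exposed c A s : {set edge nb nw} := [set e | fresh c A s e].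
Definition found c A s : {set edge nb nw} := [set e | A e && fresh c A s e].
Definition colour_count c s : nat := count (fun v => black v == c) s.

Lemma index_prefix r s v : prefix r s -> v \in r -> index v s = index v r.
Proof. by move=> /prefixP[t ->] vr; rewrite index_cat vr. Qed.

Lemma mem_take_index (T : eqType) (v w : T) (t : seq T) :
  v \in t -> (v \in take (index w t) t) = (index v t < index w t)%N.
Proof.
move=> vt; apply/idP/idP => [vq|lt].
- apply: leq_trans (_ : size (take (index w t) t) <= _)%N; last first.
    by rewrite size_take_min geq_minl.
  by rewrite -(cat_take_drop (index w t) t) index_cat vq cat_take_drop index_mem.
- rewrite -(nth_index v vt) -(nth_take v lt); apply: mem_nth.
  by rewrite size_take_min leq_min lt index_mem.
Qed.

(** Freshness refers only to [A] and to the part of the run before the endpoint of colour [c], so it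
    is settled once that endpoint is reached. *)
Lemma fresh_prefix c A r s e : prefix r s -> endpoint c e \in r ->
  fresh c A s e = fresh c A r e.
Proof.
move=> rs er; rewrite /fresh (index_prefix rs er) er.
have /prefixP[t ->] := rs.
by rewrite mem_cat er take_cat index_mem er.
Qed.

(** Until [e'] is uncovered, neither its weight nor its membership in [A] has been consulted. So the
    freshness of [e'] and of an edge uncovered no later, and both times, survive any change at
    [e']. *)
Lemma fresh_coupling c A A' u u' x m e e' :
  let s := prim u x m in let s' := prim u' x m in
  (forall f g, f != e' -> g != e' -> (u f <= u g) = (u' f <= u' g)) ->
  (forall f, f != e' -> A f = A' f) ->
  fresh c A s e -> fresh c A s e' ->
  (index (endpoint c e) s <= index (endpoint c e') s)%N ->
  [/\ fresh c A' s' e, fresh c A' s' e',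
      index (endpoint c e) s' = index (endpoint c e) s &
      index (endpoint c e') s' = index (endpoint c e') s].
Proof.
move=> s s' uu' AA' fe fe' ee'.
have es : endpoint c e \in s by case/and3P: fe.
have es' : endpoint c e' \in s by case/and3P: fe'.
(* [r] is the run up to and including the endpoint of [e'] of colour [c]; as [e'] is fresh, no
   endpoint of it occurs before. *)
pose q := take (index (endpoint c e') s) s; pose r := rcons q (endpoint c e').
have rE : r = take (index (endpoint c e') s).+1 s.
  by rewrite (take_nth (endpoint c e')) ?index_mem // nth_index.
have rs : prefix r s by rewrite rE; exact: prefix_take.
have eq : endpoint c e' \notin q by rewrite mem_take_index // ltnn.
have eq' : endpoint (~~ c) e' \notin q by case/and3P: fe'.
have rs' : prefix r s'.
  apply: prim_prefix_coupling uu' _ rs => c'.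
  have [-> //|ne] := eqVneq c' c.
  by have -> : c' = ~~ c by move: ne; case: (c'); case: (c).
have er : endpoint c e \in r.
  by rewrite rE in_take_leq ?ltnS // index_mem.
have er' : endpoint c e' \in r by rewrite mem_rcons inE eqxx.
(* Here [A] is tested only on edges whose endpoint of colour [c] precedes the last vertex of [r],
   hence never on [e']. *)
have same f : endpoint c f \in r -> fresh c A r f -> fresh c A' r f.
  move=> fr /and3P[_ h1 /forallP h2]; apply/and3P; split=> //.
  apply/forallP => g; apply/implyP => /andP[g1 g2].
  rewrite -AA'; first by have := h2 g; rewrite g1 g2.
  apply: contraNneq eq => <-; move: g2.
  have fsz : (index (endpoint c f) r <= size q)%N.
    by rewrite -ltnS -(size_rcons q (endpoint c e')) index_mem.
  have rq : r = q ++ [:: endpoint c e'] by rewrite cats1.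
  rewrite [X in take _ X]rq takel_cat //.
  exact: mem_take.
split.
- by rewrite (fresh_prefix _ rs' er); apply: same => //; rewrite -(fresh_prefix _ rs er).
- by rewrite (fresh_prefix _ rs' er'); apply: same => //; rewrite -(fresh_prefix _ rs er').
- by rewrite (index_prefix rs er) (index_prefix rs' er).
- by rewrite (index_prefix rs er') (index_prefix rs' er').
Qed.

(** Among the edges of [A] from reached vertices to this target, the one whose source is reached
    first is fresh, as the target is not reached before the source of [f]. *)
Lemma found_target c A s f : A f -> endpoint c f \in s ->
  endpoint (~~ c) f \notin take (index (endpoint c f) s) s ->
  endpoint (~~ c) f \in [set endpoint (~~ c) e | e in found c A s].
Proof.
move=> Af fs nf.
pose P := [pred g | [&& A g, endpoint c g \in s & endpoint (~~ c) g == endpoint (~~ c) f]].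
have Pf : P f by rewrite /= Af fs eqxx.
case: (arg_minnP (fun g => index (endpoint c g) s) Pf) => g /and3P[Ag gs /eqP eg] ming.
rewrite -eg; apply: imset_f; rewrite inE Ag /fresh gs /=; apply/andP; split.
- rewrite eg; apply: contra nf => h.
  have fs' : endpoint (~~ c) f \in s by exact: mem_take h.
  rewrite !mem_take_index // in h *.
  exact: leq_trans h (ming _ Pf).
- apply/forallP => h; apply/implyP => /andP[/eqP hg hq]; apply/negP => Ah.
  have hs : endpoint c h \in s by exact: mem_take hq.
  have := ming h; rewrite /= Ah hs hg eg eqxx => /(_ isT).
  by rewrite leqNgt -mem_take_index // hq.
Qed.

(** Of two found edges with the same target, the one uncovered later would not be fresh. Found edges
    can thus be counted by their targets. *)
Lemma found_inj c A s : {in found c A s &, injective (endpoint (~~ c))}.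
Proof.
move=> e f; rewrite !inE => /andP[Ae /and3P[es _ /forallP he]].
move=> /andP[Af /and3P[fs _ /forallP hf]] ef.
apply: (@endpoint_inj _ _ c) => //.
have [lt|lt|] := ltngtP (index (endpoint c e) s) (index (endpoint c f) s).
- by have := hf e; rewrite ef eqxx mem_take_index // lt Ae.
- by have := he f; rewrite ef eqxx mem_take_index // lt Af.
- by move=> ei; rewrite -(nth_index (endpoint c e) es) ei nth_index.
Qed.

Lemma card_colour c s : uniq s ->
  #|[set v in s | black v == c]| = colour_count c s.
Proof.
move=> us; rewrite /colour_count -size_filter -(card_uniqP _) ?filter_uniq //.
by apply: eq_card => v; rewrite !inE mem_filter andbC.
Qed.

Lemma card_exposed_le c A s : uniq s ->
  (#|exposed c A s| <= colour_count c s * colour_size nb nw (~~ c))%N.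
Proof.
move=> us; rewrite -card_colour // -(card_black (~~ c)) -cardsX.
pose h e := (endpoint c e, endpoint (~~ c) e).
have hinj : injective h by move=> e f [? ?]; apply: (@endpoint_inj _ _ c).
rewrite -(card_imset _ hinj); apply: subset_leq_card.
apply/fintype.subsetP => _ /imsetP[e + ->].
by rewrite !inE /= !black_endpoint !eqxx andbT => /and3P[-> _ _].
Qed.

(** A pair of a reached vertex and a vertex of the opposite colour fails to be exposed only if the
    latter is reached or is the target of a found edge; [D] collects these exceptions. *)
Lemma card_exposed_ge c A s : uniq s ->
  (colour_count c s * colour_size nb nw (~~ c) <=
   #|exposed c A s| + colour_count c s * (size s + #|found c A s|))%N.
Proof.
move=> us; rewrite -card_colour // -(card_black (~~ c)) -cardsX.
pose h e := (endpoint c e, endpoint (~~ c) e).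
have hinj : injective h by move=> e f [? ?]; apply: (@endpoint_inj _ _ c).
set B := [set v in s | _].
set D := [set v in s] :|: [set endpoint (~~ c) e | e in found c A s].
apply: (@leq_trans #|(h @: exposed c A s) :|: finset.setX B D|).
  apply: subset_leq_card; apply/fintype.subsetP => -[v v']; rewrite /B /D.
  rewrite !inE /= => /andP[/andP[vs /eqP vc] /eqP v'c].
  have [e ev ev'] := join_vertices vc v'c.
  rewrite vs vc eqxx /=. have [_|v's] := boolP (v' \in s); first by rewrite orbT.
  have [fe|] := boolP (fresh c A s e).
    by rewrite -ev -ev' (imset_f h) // inE.
  rewrite /fresh ev vs ev' /= negb_and negbK.
  case/orP => [/mem_take|]; first by rewrite (negbTE v's).
  move=> /forallPn[f]; rewrite negb_imply negbK.
  move=> /andP[/andP[/eqP fv' fq] Af]; apply/orP; right.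
  rewrite -fv'; apply: found_target => //; first exact: mem_take fq.
  by rewrite fv'; apply: contra v's => /mem_take.
rewrite (leq_trans (leq_card_setU _ _)) // (card_imset _ hinj) leq_add2l cardsX.
rewrite leq_mul2l; apply/orP; right.
rewrite (leq_trans (leq_card_setU _ _)) //; apply: leq_add; last exact: leq_imset_card.
by rewrite cardsE (card_uniqP us).
Qed.

Lemma card_found_mono c A r s : prefix r s -> (#|found c A r| <= #|found c A s|)%N.
Proof.
move=> rs; apply: subset_leq_card; apply/fintype.subsetP => e.
rewrite !inE => /andP[-> /[dup] fe /and3P[er _ _]].
by rewrite (fresh_prefix _ rs er).
Qed.

(** Found edges have distinct targets, and a target outside the run would make an edge of [A]
    cross. *)
Lemma card_found_le c A s : uniq s ->
  (forall e, crossing [set v in s] e -> ~~ A e) ->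
  (#|found c A s| <= colour_count (~~ c) s)%N.
Proof.
move=> us nA; rewrite -card_colour // -(card_in_imset (@found_inj c A s)).
apply: subset_leq_card; apply/fintype.subsetP => _ /imsetP[e + ->].
rewrite !inE black_endpoint eqxx andbT => /andP[Ae /and3P[es _ _]].
apply: contraLR Ae => nes; apply: nA.
by rewrite (crossingE c) !inE es (negbTE nes).
Qed.

(** After time [m] every step uses the lightest crossing edge, whose weight is thus at most [p]; if
    the vertex it adds has colour [~~ c], that vertex is the target of a found edge. *)
Lemma colour_count_le c u (p : R) x m k :
  (k <= nb + nw)%N -> (0 < nb)%N -> (0 < nw)%N -> (m <= k)%N ->
  let A := fun e => u e <= p in
  (forall i, (m < i < k)%N -> exists2 e, crossing (Sigma u x i) e & A e) ->
  (colour_count (~~ c) (prim u x k) <= #|found c A (prim u x k)| + m.+1)%N.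
Proof.
move=> kn nb0 nw0 mk A big; set s := prim u x k.
(* The vertex at index [i] is added to [Sigma u x i], which [big] covers for [m < i] only; so the
   first [m.+1] vertices are counted trivially. *)
rewrite /colour_count -(cat_take_drop m.+1 s) count_cat addnC cat_take_drop.
apply: leq_add; last first.
  by rewrite (leq_trans (count_size _ _)) // size_take_min geq_minl.
have us : uniq s by exact: prim_uniq.
have ud : uniq (drop m.+1 s) by rewrite drop_uniq.
rewrite -/(colour_count _ _) -card_colour //.
apply: leq_trans (leq_imset_card (endpoint (~~ c)) _).
apply: subset_leq_card; apply/fintype.subsetP => v.
rewrite inE => /andP[vs /eqP vc].
pose i := index v s.
have vs' : v \in s by exact: mem_drop vs.
have mi : (m < i)%N.
  rewrite ltnNge; apply: contraL vs => im.
  have vt : v \in take m.+1 s by rewrite in_take.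
  have := us; rewrite -{1}(cat_take_drop m.+1 s) cat_uniq.
  by case/and3P=> _ /hasPn h _; apply: contraL vt => /h.
have ik : (i < k)%N by rewrite -(size_prim u x kn nb0 nw0) index_mem.
have szi j : (j <= k)%N -> size (prim u x j) = j.
  by move=> jk; rewrite size_prim // (leq_trans jk).
have [f crf Af] := big i (introT andP (conj mi ik)).
(* Without a minimal crossing edge the run would not grow to length [i.+1]. *)
have primS : exists2 e, min_edge u (Sigma u x i) = Some e &
    prim u x i.+1 = rcons (prim u x i) (outer_endpoint (Sigma u x i) e).
  have := szi i.+1 ik; have := szi i (ltnW ik).
  case: (i) mi => // i' _; rewrite !primSS.
  case: min_edge => [e _ _|-> /eqP]; first by exists e.
  by rewrite eqn_leq ltnn andbF.
have [e me primE] := primS.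
have [cre mine] := min_edge_crossing me.
have [c' [es nes outE]] := outer_endpointP cre.
have vE : v = endpoint (~~ c') e.
  have /prefixP[t st] := prim_prefix u x ik.
  have := nth_index v vs'; rewrite -/i -/s {1}/s st primE -cats1 -catA nth_cat.
  by rewrite (szi i (ltnW ik)) ltnn subnn /= outE.
have {c' es nes outE vE} [es vE] : endpoint c e \in Sigma u x i /\ v = endpoint (~~ c) e.
  have -> : c = c' by apply/negb_inj; rewrite -vc vE black_endpoint.
  by [].
have /prefixP[t st] := prim_prefix u x (ltnW ik).
have es' : endpoint c e \in prim u x i by move: es; rewrite inE.
have lt : (index (endpoint c e) s < i)%N.
  by rewrite /s st index_cat es' -{2}(szi i (ltnW ik)) index_mem.
rewrite vE; apply: found_target.
- exact: le_trans (mine _ crf) Af.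
- by rewrite /s st mem_cat es'.
- by rewrite mem_take_index -vE // -leqNgt ltnW.
Qed.

End FreshEdges.

(** * Proportions near criticality *)

(** Here [x0], [y0] are the black and white counts at the last time [M] without a light crossing
    edge, and [x], [y] those at time [K]. The lower bounds, supercritical by a factor [1 + e], force
    [M] to be [O(e K)]; the upper bounds then put [y] close to [g x]. *)
Lemma near_critical_balance (R : realType) (x0 y0 x y h K M e D g gi G : R) :
  0 <= x0 -> 0 <= y0 -> 0 <= x -> 0 <= y -> 0 <= h ->
  x0 + y0 = M -> x + y = K -> 0 < K ->
  0 < e <= 1 -> D = e ^+ 2 -> h <= D * K -> 1 <= e * K ->
  0 < g <= G -> 0 < gi <= G -> g * gi = 1 -> 1 <= G ->
  (1 + e) * g * (x0 - h) - 2 * (D * K) <= y0 ->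
  (1 + e) * gi * (y0 - h) - 2 * (D * K) <= x0 ->
  y <= (1 + e) * g * x + D * K + (M + 1) ->
  x <= (1 + e) * gi * y + D * K + (M + 1) ->
  `|x / K - 1 / (1 + g)| <= 11 * G ^+ 4 * e.
Proof.
move=> x00 y00 x0' y0' h0 xyM xyK K0 /andP[e0 e1] DE hD eK /andP[g0 gG] /andP[gi0 giG]
  ggi G1 lo1 lo2 up1 up2.
have D0 : 0 <= D by rewrite DE sqr_ge0.
have DK0 : 0 <= D * K by rewrite mulr_ge0 // ltW.
have G0 : 0 < G by lra.
have GD1 : D * K <= G * (D * K) by rewrite ler_peMl.
(* The cost of replacing [x0 - h] by [x0], from [1 + e <= 2] and [h <= D K]. *)
have slack t : 0 < t -> t <= G -> (1 + e) * t * h <= 2 * (G * (D * K)).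
  move=> t0 tG; have -> : 2 * (G * (D * K)) = (2 * G) * (D * K) by ring.
  apply: ler_pM => //; first by rewrite mulr_ge0 ?ltW //; lra.
  by apply: ler_pM; lra.
have s1 := slack _ g0 gG; have s2 := slack _ gi0 giG.
have l1 : (1 + e) * g * x0 - 4 * (G * (D * K)) <= y0.
  by have := lo1; rewrite mulrBr; lra.
have l2 : (1 + e) * gi * y0 - 4 * (G * (D * K)) <= x0.
  by have := lo2; rewrite mulrBr; lra.
have l2' : (1 + e) * y0 - 4 * (G ^+ 2 * (D * K)) <= g * x0.
  have : g * ((1 + e) * gi * y0 - 4 * (G * (D * K))) <= g * x0 by rewrite ler_pM2l.
  have -> : g * ((1 + e) * gi * y0 - 4 * (G * (D * K))) =
    (1 + e) * (g * gi) * y0 - 4 * (g * (G * (D * K))) by ring.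
  rewrite ggi mulr1; apply: le_trans.
  rewrite lerB // ler_pM2l // expr2 -mulrA ler_wpM2r //.
  by rewrite mulr_ge0 // ltW.
have GG : G * (D * K) <= G ^+ 2 * (D * K).
  by rewrite expr2 -mulrA ler_peMl // mulr_ge0 // ltW.
(* Adding the two lower bounds cancels [g x0 + y0] and leaves [e] times it. *)
have egM : e * (g * x0 + y0) <= 8 * (G ^+ 2 * (D * K)) by lra.
have MG : M <= G * (g * x0 + y0).
  rewrite -xyM mulrDr mulrA lerD //; last by rewrite ler_peMl.
  rewrite ler_peMl //.
  by rewrite -ggi mulrC ler_pM2r.
(* Dividing by [e] turns the error [D K = e^2 K] into [e K]; this is why deviations are required to
   be of order [e^2]. *)
have MK : M <= 8 * G ^+ 3 * (e * K).
  rewrite -(ler_pM2l e0).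
  apply: (@le_trans _ _ (G * (e * (g * x0 + y0)))).
    by rewrite [leRHS]mulrCA ler_pM2l.
  apply: (@le_trans _ _ (G * (8 * (G ^+ 2 * (D * K))))); first by rewrite ler_pM2l.
  by rewrite DE le_eqVlt; apply/orP; left; apply/eqP; ring.
have G3 : 1 <= G ^+ 3 by rewrite exprn_ege1.
have GG3 : G <= G ^+ 3 by rewrite exprS ler_peMr ?exprn_ege1 // ltW.
have eK0 : 0 <= e * K by rewrite mulr_ge0 // ltW.
have G3eK : e * K <= G ^+ 3 * (e * K) by rewrite ler_peMl.
have GeK : G * (e * K) <= G ^+ 3 * (e * K) by rewrite ler_wpM2r.
have DKe : D * K <= e * K by rewrite DE expr2 -mulrA ler_piMl.
have xK : x <= K by lra.
have yK : y <= K by lra.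
have eg t z : 0 < t -> t <= G -> 0 <= z -> z <= K -> e * t * z <= G * (e * K).
  move=> t0 tG z0 zK; have -> : G * (e * K) = e * G * K by ring.
  by apply: ler_pM => //; [rewrite mulr_ge0 // ltW|rewrite ler_pM2l].
(* The constant is 8 for [M] plus one each for [D K], the term 1 and [e g x]. *)
have d1 : y - g * x <= 11 * (G ^+ 3 * (e * K)).
  have h1 := eg _ _ g0 gG x0' xK.
  have -> : y - g * x = y - (1 + e) * g * x + e * g * x by ring.
  by lra.
have d2 : x - gi * y <= 11 * (G ^+ 3 * (e * K)).
  have h1 := eg _ _ gi0 giG y0' yK.
  have -> : x - gi * y = x - (1 + e) * gi * y + e * gi * y by ring.
  by lra.
have G3e0 : 0 <= 11 * (G ^+ 3 * (e * K)).
  by rewrite mulr_ge0 // mulr_ge0 // exprn_ge0 // ltW.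
have d1' : y - g * x <= 11 * G ^+ 4 * e * K.
  apply: le_trans d1 _.
  have -> : 11 * G ^+ 4 * e * K = G * (11 * (G ^+ 3 * (e * K))) by ring.
  by rewrite ler_peMl.
have d2' : g * x - y <= 11 * G ^+ 4 * e * K.
  have -> : 11 * G ^+ 4 * e * K = G * (11 * (G ^+ 3 * (e * K))) by ring.
  have -> : g * x - y = g * (x - gi * y) by rewrite mulrBr mulrA ggi mul1r.
  apply: (@le_trans _ _ (g * (11 * (G ^+ 3 * (e * K))))); first by rewrite ler_pM2l.
  by rewrite ler_wpM2r.
have g1 : 0 < 1 + g by lra.
have -> : x / K - 1 / (1 + g) = (g * x - y) / (K * (1 + g)).
  by rewrite -xyK; field; rewrite xyK ?lt0r_neq0.
rewrite normrM normfV (gtr0_norm (mulr_gt0 K0 g1)) ler_pdivrMr ?mulr_gt0 //.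
have : `|g * x - y| <= 11 * G ^+ 4 * e * K by rewrite ler_norml d2' andbT; lra.
move=> /le_trans; apply; rewrite [leRHS]mulrA ler_peMr //; last by lra.
by rewrite !mulr_ge0 ?exprn_ge0 // ltW.
Qed.

(** * The black proportion on runs with small deviations *)

Section Balance.
Context {R : realType} {nb nw : nat}.
Implicit Types (u : edge nb nw -> R) (x : vertex nb nw) (k m : nat) (c : bool).

Definition small (p : R) u : pred (edge nb nw) := fun e => u e <= p.

Definition deviation c p u x m : R :=
  #|found c (small p u) (prim u x m)|%:R
  - p * #|exposed c (small p u) (prim u x m)|%:R.

Lemma size_prim_le u x k : (size (prim u x k) <= k)%N.
Proof.
elim: k => // -[//|k] IH; rewrite primSS.
by case: min_edge => [e|]; rewrite ?size_rcons // ltnW.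
Qed.

Lemma card_Sigma_black u x k : #|Sigma_black u x k| = colour_count true (prim u x k).
Proof.
rewrite -card_colour ?prim_uniq //; apply: eq_card => -[b|w]; rewrite !inE /=.
  by rewrite (mem_imset _ _ inl_inj).
by congr andb; apply/imsetP => -[].
Qed.

Lemma colour_countD c (s : seq (vertex nb nw)) :
  (colour_count c s + colour_count (~~ c) s = size s)%N.
Proof.
rewrite -(count_predC (fun v => black v == c) s); congr addn.
by apply: eq_count => v /=; case: c (black v) => -[].
Qed.

(** The deterministic half of the proof. Deviations are assumed small only at [k] and at multiples
    of [h]: the second moment bound concerns fixed times, whereas the last time without a light
    crossing edge depends on the weights. *)
Lemma rho_near_critical u x k h (p e g G : R) :
  (0 < k <= nb + nw)%N -> (0 < nb)%N -> (0 < nw)%N -> (0 < h)%N ->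
  0 < e <= 1 -> 0 < g <= G -> 0 < g^-1 <= G -> 1 <= G -> 0 <= p ->
  p * nw%:R = (1 + e) * g -> p * nb%:R = (1 + e) * g^-1 ->
  h%:R <= e ^+ 2 * k%:R -> 1 <= e * k%:R ->
  p * k%:R * (2 + 2 * G) <= e ^+ 2 ->
  (forall c m, (m <= k)%N -> (m == k) || (h %| m)%N ->
     `|deviation c p u x m| <= e ^+ 2 * k%:R) ->
  `|rho u x k - 1 / (1 + g)| <= 11 * G ^+ 4 * e.
Proof.
move=> /andP[k0 kn] nb0 nw0 h0 e01 gG giG G1 p0 pw pb hk ek pk dev.
have /andP[e0 e1] := e01; have /andP[g0 gG'] := gG; have /andP[gi0 giG'] := giG.
pose s m := prim u x m; pose D : R := e ^+ 2; pose K : R := k%:R.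
have K0 : 0 < K by rewrite ltr0n.
have D0 : 0 <= D by rewrite sqr_ge0.
have D1 : D <= 1 by rewrite expr_le1 // ltW.
pose rate c : R := p * (colour_size nb nw (~~ c))%:R.
have rate0 c : 0 <= rate c by rewrite mulr_ge0.
have rateG c : rate c <= 2 * G.
  have t z : 0 < z -> z <= G -> (1 + e) * z <= 2 * G.
    by move=> z0 zG; apply: ler_pM; lra.
  by case: c; rewrite /rate /= ?pw ?pb t.
pose cnt c m : R := (colour_count c (s m))%:R.
pose F c m : R := #|found c (small p u) (s m)|%:R.
have szs m : (m <= k)%N -> size (s m) = m.
  by move=> mk; rewrite size_prim // (leq_trans mk).
have cntD c m : (m <= k)%N -> cnt c m + cnt (~~ c) m = m%:R.
  by move=> mk; rewrite -natrD colour_countD szs.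
have cnt0 c m : 0 <= cnt c m by [].
have up c m : (m <= k)%N -> (m == k) || (h %| m)%N ->
    F c m <= rate c * cnt c m + D * K.
  move=> mk hm; have := dev c m mk hm.
  rewrite ler_norml => /andP[_]; rewrite /deviation -/(s m) -/(F c m) -/D -/K.
  have : (#|exposed c (small p u) (s m)|%:R : R) <= cnt c m * (colour_size nb nw (~~ c))%:R.
    by rewrite -natrM ler_nat card_exposed_le ?prim_uniq.
  move=> /(ler_wpM2l p0); rewrite mulrCA -/(rate c) [cnt _ _ * _]mulrC; lra.
have Fmono c m m' : (m <= m')%N -> F c m <= F c m'.
  by move=> mm; rewrite ler_nat card_found_mono ?prim_prefix.
have cntk c m : (m <= k)%N -> cnt c m <= K.
  move=> mk; rewrite ler_nat (leq_trans (count_size _ _)) //.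
  by rewrite (leq_trans (size_prim_le _ _ _)).
have Fk c m : (m <= k)%N -> F c m <= (2 * G + 1) * K.
  move=> mk; apply: le_trans (Fmono c _ _ mk) _.
  have /le_trans := up c k (leqnn k) (introT orP (or_introl (eqxx k))); apply.
  rewrite mulrDl mul1r; apply: lerD; last by rewrite ler_piMl // ltW.
  by apply: ler_pM => //; exact: cntk.
have lo c m : (m <= k)%N -> (h %| m)%N -> rate c * cnt c m - 2 * (D * K) <= F c m.
  move=> mk hm; have := dev c m mk (introT orP (or_intror hm)).
  rewrite ler_norml => /andP[+ _]; rewrite /deviation -/(s m) -/(F c m) -/D -/K.
  set E : R := _%:R; move=> dlo.
  have : cnt c m * (colour_size nb nw (~~ c))%:R <= E + cnt c m * (m%:R + F c m).
    rewrite -natrD -!natrM -natrD ler_nat.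
    have := card_exposed_ge c (small p u) (prim_uniq u x m).
    by rewrite -/(s m) szs.
  move=> /(ler_wpM2l p0).
  rewrite mulrCA -/(rate c) [cnt _ _ * rate c]mulrC mulrDr.
  (* The pairs missing from [E] are at most of order [K^2]; as [p K] is at most of order [e^2], they
     cost no more than [D K]. *)
  have : p * (cnt c m * (m%:R + F c m)) <= D * K.
    apply: (@le_trans _ _ (p * (K * ((2 + 2 * G) * K)))).
      apply: ler_wpM2l => //; apply: ler_pM => //; first by rewrite addr_ge0.
        exact: cntk.
      have := Fk c m mk; have : (m%:R : R) <= K by rewrite ler_nat.
      by rewrite !mulrDl; lra.
    have -> : p * (K * ((2 + 2 * G) * K)) = p * K * (2 + 2 * G) * K by ring.
    by rewrite ler_wpM2r // ltW.
  by lra.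
(* [m0] will be the last time up to [k] with no crossing edge of weight at most [p]; such a time
   exists, as nothing crosses at time 0. *)
pose closed m := (m <= k)%N && [forall e, crossing (Sigma u x m) e ==> ~~ small p u e].
have closed0 : closed 0%N.
  rewrite /closed /=; apply/forallP => f; apply/implyP.
  by rewrite /crossing !inE.
have closed_le m : closed m -> (m <= k)%N by case/andP.
case: (ex_maxnP (ex_intro _ 0%N closed0) closed_le) => m0 /andP[m0k nocross] m0max.
have Fm0 c : F c m0 <= cnt (~~ c) m0.
  rewrite ler_nat card_found_le ?prim_uniq // => f.
  exact/implyP/(forallP nocross).
(* Rounding [m0] down to the grid loses at most [h] vertices, and [F] is monotone. *)
pose m := ((m0 %/ h) * h)%N.
have mm0 : (m <= m0)%N by rewrite leq_divM.
have mh : (m0 <= m + h)%N by rewrite {1}(divn_eq m0 h) leq_add2l ltnW // ltn_pmod.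
have low c : rate c * (cnt c m0 - h%:R) - 2 * (D * K) <= cnt (~~ c) m0.
  apply: le_trans (Fm0 c); apply: le_trans (Fmono c _ _ mm0).
  apply: le_trans (lo c m (leq_trans mm0 m0k) (dvdn_mull _ (dvdnn _))).
  rewrite lerD2r ler_wpM2l // lerBlDr -natrD ler_nat.
  have /prefixP[t st] := prim_prefix u x mm0.
  rewrite /s st /colour_count count_cat leq_add2l.
  rewrite (leq_trans (count_size _ _)) //.
  have : size (s m0) = (size (s m) + size t)%N by rewrite /s st size_cat.
  rewrite !szs ?(leq_trans mm0) // => m0E.
  by rewrite -(leq_add2l m) -m0E.
have high c : cnt (~~ c) k <= rate c * cnt c k + D * K + (m0%:R + 1).
  have := @colour_count_le _ nb nw c u p x m0 k kn nb0 nw0 m0k.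
  have H i : (m0 < i < k)%N -> exists2 e, crossing (Sigma u x i) e & u e <= p.
    move=> /andP[m0i ik]; have : ~~ closed i.
      by apply: contraTN m0i => /m0max; rewrite -leqNgt.
    rewrite /closed (ltnW ik) /= => /forallPn[f].
    by rewrite negb_imply negbK => /andP[]; exists f.
  move=> /(_ H); rewrite -(ler_nat R) natrD => /le_trans; apply.
  by rewrite -natr1 lerD2r up // eqxx.
rewrite /rho card_Sigma_black -/(s k) -/(cnt true k) -/K.
have rt : rate true = (1 + e) * g by [].
have rf : rate false = (1 + e) * g^-1 by [].
apply: (@near_critical_balance _ (cnt true m0) (cnt false m0) _ (cnt false k)
  h%:R K m0%:R e D g g^-1 G) => //.
- exact: cntD true _ m0k.
- exact: cntD true _ (leqnn k).
- by rewrite divff // gt_eqF.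
- by rewrite -rt; exact: (low true).
- by rewrite -rf; exact: (low false).
- by rewrite -rt; exact: (high true).
- by rewrite -rf; exact: (high false).
Qed.

End Balance.

(** * Second moments *)

Local Open Scope classical_set_scope.

Lemma fsbig_finType (S : Type) (idx : S) (op : Monoid.com_law idx) (J : finType)
    (phi : pred J) (f : J -> S) :
  \big[op/idx]_(j \in [set` phi]) f j = \big[op/idx]_(j | phi j) f j.
Proof.
rewrite fsbig_finite /=; last exact: finite_finset.
rewrite -[RHS]big_filter; apply: perm_big; apply: uniq_perm.
- exact: finmap.fset_uniq.
- by rewrite filter_uniq ?index_enum_uniq.
move=> w; rewrite mem_filter mem_index_enum andbT in_fset_set; last exact: finite_finset.
by apply/idP/idP; rewrite inE.
Qed.

(** * Events determined by finitely many Boolean events *)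

Section FinitePatterns.
Context {d : measure_display} {T : measurableType d} {I : finType}.
Variable b : I -> T -> bool.
Hypothesis mb : forall i, measurable [set t | b i t].

Lemma measurable_atom (w : {ffun I -> bool}) :
  measurable [set t | [ffun i => b i t] = w].
Proof.
have -> : [set t | [ffun i => b i t] = w] =
    \bigcap_(i in [set: I]) [set t | b i t = w i].
  apply/seteqP; split => t /=; first by move=> <- i _; rewrite ffunE.
  by move=> h; apply/ffunP => i; rewrite ffunE; exact: h.
apply: fin_bigcap_measurable => [|i _]; first exact: finite_finset.
case: (w i); first exact: mb.
have -> : [set t | b i t = false] = ~` [set t | b i t].
  by apply/seteqP; split => t /=; [move=> ->|move/negP/negbTE].
exact: measurableC.
Qed.

Lemma measurable_pattern (F : T -> bool) :
  (forall t t', (forall i, b i t = b i t') -> F t = F t') ->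
  measurable [set t | F t].
Proof.
move=> hF.
have -> : [set t | F t] = \bigcup_(w in [set w | exists2 t, F t & [ffun i => b i t] = w])
    [set t | [ffun i => b i t] = w].
  apply/seteqP; split => t /=.
    by move=> Ft; exists [ffun i => b i t] => //; exists t.
  move=> [w [t' Ft' <-]] /= /ffunP e; rewrite (hF t t') // => i.
  by have := e i; rewrite !ffunE.
by apply: fin_bigcup_measurable => [|w _]; [exact: finite_finset|exact: measurable_atom].
Qed.

Lemma measure_pattern {R : realType} (P : probability T R) (phi : pred {ffun I -> bool}) :
  fine (P [set t | phi [ffun i => b i t]]) =
  \sum_(w | phi w) fine (P [set t | [ffun i => b i t] = w]).
Proof.
have -> : [set t | phi [ffun i => b i t]] =
    \bigcup_(w in [set` phi]) [set t | [ffun i => b i t] = w].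
  apply/seteqP; split => t /=; first by move=> ?; exists [ffun i => b i t].
  by move=> [w ? /= ->].
rewrite measure_fin_bigcup //; last first.
- by move=> w _; exact: measurable_atom.
- by move=> w w' _ _ [t [/= -> ->]].
rewrite fsbig_finType -sum_fine // => w _.
exact: fin_num_measure (measurable_atom w).
Qed.

End FinitePatterns.

(** The comparisons among the weights and with [p] form a finite pattern, and each is measurable
    when [T] is given the sigma-algebra generated by [Y]. Membership there, rather than mere
    measurability, is what independence needs. *)
Lemma pattern_sigma_algebra {R : realType} {d} {T : measurableType d} {I : finType}
    (Y : I -> T -> R) (p : R) (F : T -> bool) :
  (forall t t', (forall f g, (Y f t <= Y g t) = (Y f t' <= Y g t')) ->
     (forall f, (Y f t <= p) = (Y f t' <= p)) -> F t = F t') ->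
  sigma_algebra_of Y [set t | F t].
Proof.
move=> hF; set G := [set B | exists i, exists2 A : set R, measurable A & B = Y i @^-1` A].
pose T' : measurableType G.-sigma := g_sigma_algebraType G.
have mY i : measurable_fun [set: T'] (Y i : T' -> R).
  by move=> _ A mA; rewrite setTI; apply: sub_sigma_algebra; exists i, A.
pose b (i : I * I + I) (t : T') : bool :=
  match i with inl (f, g) => Y f t <= Y g t | inr f => Y f t <= p end.
apply: (@measurable_pattern _ T' _ b) => [[[f g]|f]|t t' bt]; last 1 first.
- by apply: hF => [f g|f]; [exact: (bt (inl (f, g)))|exact: (bt (inr f))].
- have := measurable_fun_le (@measurableT _ T') (mY f) (mY g).
  by rewrite setTI.
- have := measurable_fun_le (@measurableT _ T') (mY f) (measurable_cst p).
  by rewrite setTI.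
Qed.

(** [P] restricted to the event that [X e] lies in [A], and [P] scaled by the probability of that
    event, agree on the pi-system [G] of intersections of events of the other variables, hence on
    the sigma-algebra it generates. *)
Lemma independent_of_others {R : realType} {d : measure_display} {T : measurableType d}
    (P : probability T R) {I : finType} (X : I -> {RV P >-> R}) (e : I) (A : set R)
    (B : set T) :
  mutually_independent P (fun i => X i : T -> R) -> measurable A ->
  sigma_algebra_of (fun f : {f | f != e} => X (val f) : T -> R) B ->
  P (X e @^-1` A `&` B) = (P (X e @^-1` A) * P B)%E.
Proof.
move=> ind mA sB.
pose Z : {set I} := finset.setC (finset.set1 e).
pose G : set (set T) := [set B | exists2 A' : I -> set R, forall i, measurable (A' i) &
  B = \bigcap_(i in [set` Z]) (X i @^-1` A' i)].
have mX i (A' : set R) : measurable A' -> measurable (X i @^-1` A').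
  by move=> mA'; rewrite -[X in measurable X]setTI; exact: measurable_funP.
have mG : G `<=` measurable.
  move=> _ [A' mA' ->]; apply: fin_bigcap_measurable => [|i _].
    exact: finite_finset.
  exact: mX.
have GT : G setT.
  exists (fun=> setT) => //; apply/seteqP; split=> // t _ i _ //.
have GI : setI_closed G.
  move=> _ _ [A1 mA1 ->] [A2 mA2 ->]; exists (fun i => A1 i `&` A2 i).
    by move=> i; exact: measurableI.
  by rewrite -bigcapI.
have mXA : measurable (X e @^-1` A) by exact: mX.
have [q qE] : exists q : {nonneg R}, P (X e @^-1` A) = q%:num%:E.
  by exists (NngNum (fine_ge0 (measure_ge0 P (X e @^-1` A)))); rewrite /= fineK ?fin_num_measure.
have GB : <<s G >> B.
  move: sB; apply: sub_sigma_algebra2 => _ [[f fe] [A1 mA1 ->]] /=.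
  exists (fun i => if i == f then A1 else setT) => [i|]; first by case: ifP.
  apply/seteqP; split => t /= h; last first.
    by have := h f; rewrite eqxx; apply; rewrite /= !inE.
  by move=> i _ /=; case: eqVneq => [->|].
have key C : G C -> P (C `&` X e @^-1` A) = (P (X e @^-1` A) * P C)%E.
  move=> [A' mA' ->].
  pose A2 i := if i == e then A else A' i.
  have mA2 i : measurable (A2 i) by rewrite /A2; case: ifP.
  have -> : \bigcap_(i in [set` Z]) (X i @^-1` A' i) `&` X e @^-1` A =
      \bigcap_(i in [set` finset.setT]) (X i @^-1` A2 i).
    apply/seteqP; split => t /=.
      move=> [h hA] i _; rewrite /= /A2; case: eqVneq => [-> //|ie].
      by apply: (h i); rewrite /= !inE.
    move=> h; split=> [i|]; last by have := h e; rewrite /= /A2 eqxx; apply; rewrite inE.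
    by rewrite /= !inE => /negbTE ie; have := h i; rewrite /= /A2 ie; apply; rewrite inE.
  rewrite ind // (ind Z) // (bigD1 e) ?inE //= {1}/A2 eqxx; congr (_ * _)%E.
  apply: eq_big => [i|i]; first by rewrite !inE.
  by rewrite /A2 => /andP[_ /negbTE ->].
have : mrestr P mXA B = mscale q P B.
  apply: (g_sigma_algebra_measure_unique G mG (fun=> setT)) => //.
  - by apply/seteqP; split => // t _; exists 0%N.
  - by move=> C GC; exact: etrans (key C GC) (congr1 (fun z => z * P C)%E qE).
  - move=> _; rewrite [ltLHS](_ : _ = P ([set: T] `&` X e @^-1` A)) //.
    by rewrite setTI qE ltry.
move=> eqB; rewrite setIC qE; exact: eqB.
Qed.

(** * Chebyshev's inequality for uncorrelated centred indicators *)

Section SecondMoment.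
Context {R : realType} {d : measure_display} {T : measurableType d}.
Variable P : probability T R.
Context {I : finType} (a h : I -> T -> bool) (p : R).
Implicit Types i j : I.

Definition prob (F : T -> bool) : R := fine (P [set t | F t]).

Hypothesis ma : forall i, measurable [set t | a i t].
Hypothesis mh : forall i, measurable [set t | h i t].
Hypothesis p0 : 0 <= p.
Hypothesis diag : forall i, prob (fun t => a i t && h i t) = p * prob (h i).
(** The product of [(a i - p) h i] and [(a j - p) h j], with Booleans read as numbers, has
    expectation 0; this is its expansion. *)
Hypothesis offdiag : forall i j, i != j ->
  prob (fun t => [&& a i t, a j t & h i t && h j t])
  - p * prob (fun t => a i t && (h i t && h j t))
  - p * prob (fun t => a j t && (h i t && h j t))
  + p ^+ 2 * prob (fun t => h i t && h j t) = 0.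

(** The mixed terms of the second moment vanish by [offdiag], and the square terms sum to at most
    [p] times the mean number of [i] with [h i]. *)
Lemma second_moment_tail (B c : R) : 0 < c ->
  (forall t, \sum_i (h i t)%:R <= B) ->
  prob (fun t => c < `|\sum_i ((a i t)%:R - p) * (h i t)%:R|) <= p * B / c ^+ 2.
Proof.
move=> c0 hB.
(* Everything depends on the finite pattern of the [a i] and [h i], so expectations are finite sums
   over patterns. *)
pose b (k : I + I) t := match k with inl i => a i t | inr i => h i t end.
have mb k : measurable [set t | b k t] by case: k => i; [exact: ma|exact: mh].
pose W := {ffun I + I -> bool}.
pose mass (w : W) := fine (P [set t | [ffun k => b k t] = w]).
have mass0 w : 0 <= mass w by rewrite fine_ge0.
pose Ex (F : W -> R) := \sum_w mass w * F w.
have ExE (F : W -> bool) : prob (fun t => F [ffun k => b k t]) = Ex (fun w => (F w)%:R).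
  rewrite /prob measure_pattern // /Ex big_mkcond; apply: eq_bigr => w _.
  by case: (F w); rewrite ?mulr1 ?mulr0.
have ExD F F' : Ex (fun w => F w + F' w) = Ex F + Ex F'.
  by rewrite /Ex -big_split; apply: eq_bigr => w _; rewrite mulrDr.
have ExZ z F : Ex (fun w => z * F w) = z * Ex F.
  by rewrite /Ex big_distrr; apply: eq_bigr => w _ /=; rewrite mulrCA.
have Exle F F' : (forall t, let w := [ffun k => b k t] in F w <= F' w) -> Ex F <= Ex F'.
  move=> FF'; apply: ler_sum => w _.
  have [[t /= <-]|none] := pselect (exists t, [ffun k => b k t] = w).
    by apply: ler_wpM2l; [exact: mass0|exact: FF' t].
  rewrite /mass (_ : [set _ | _] = set0) ?measure0 ?mul0r //.
  by apply/seteqP; split => // t /= e; apply: none; exists t.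
have Exsum (J : finType) (F : J -> W -> R) : Ex (fun w => \sum_i F i w) = \sum_i Ex (F i).
  rewrite /Ex exchange_big /=; apply: eq_bigr => w _.
  by rewrite big_distrr.
have Ex1 : Ex (fun=> 1) = 1.
  have pT : prob (fun=> true) = 1.
    by rewrite /prob (_ : [set _ | _] = setT) ?probability_setT //; apply/seteqP.
  by rewrite -[RHS]pT (ExE xpredT).
pose A i (w : W) := w (inl i); pose H i (w : W) := w (inr i).
pose x i w : R := ((A i w)%:R - p) * (H i w)%:R.
have pH i : prob (h i) = Ex (fun w => (H i w)%:R).
  by rewrite -ExE; congr prob; apply/funext => t; rewrite /H ffunE.
have xx i j : i != j -> Ex (fun w => x i w * x j w) = 0.
  move=> ij; rewrite -(offdiag ij).
  have -> : (fun w => x i w * x j w) = (fun w =>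
      ([&& A i w, A j w & H i w && H j w]%:R
       + (- p) * (A i w && (H i w && H j w))%:R)
      + ((- p) * (A j w && (H i w && H j w))%:R
      + p ^+ 2 * (H i w && H j w)%:R)).
    apply/funext => w; rewrite /x.
    by case: (A i w) (A j w) (H i w) (H j w) => [] [] [] [] /=; ring.
  rewrite !(ExD, ExZ) -!ExE addrA -!mulNr.
  congr (_ + _ * _ + _ * _ + _ * _); congr prob; apply/funext => t;
    by rewrite /A /H !ffunE.
have xxd i : Ex (fun w => x i w * x i w) <= p * prob (h i).
  have -> : (fun w => x i w * x i w) = (fun w =>
      (1 - 2 * p) * (A i w && H i w)%:R + p ^+ 2 * (H i w)%:R).
    by apply/funext => w; rewrite /x; case: (A i w) (H i w) => [] [] /=; ring.
  rewrite ExD !ExZ -pH -ExE.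
  have -> : prob (fun t => A i [ffun k => b k t] && H i [ffun k => b k t]) =
    prob (fun t => a i t && h i t).
    by congr prob; apply/funext => t; rewrite /A /H !ffunE.
  rewrite diag.
  have : 0 <= p ^+ 2 * prob (h i) by rewrite mulr_ge0 ?sqr_ge0 ?fine_ge0.
  by lra.
have -> : prob (fun t => c < `|\sum_i ((a i t)%:R - p) * (h i t)%:R|) =
    Ex (fun w => (c < `|\sum_i x i w|)%R%:R).
  rewrite -ExE; congr prob; apply/funext => t; congr (_ < `| _ |).
  by apply: eq_bigr => i _; rewrite /x /A /H !ffunE.
rewrite ler_pdivlMr ?exprn_gt0 // mulrC -ExZ.
apply: (@le_trans _ _ (Ex (fun w => (\sum_i x i w) ^+ 2))).
  apply: Exle => t /=; set w := finfun _.
  case: ltP => cx; last by rewrite mulr0 sqr_ge0.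
  by rewrite mulr1 -(real_normK (num_real (\sum_i x i w))) ler_sqr ?nnegrE // ltW.
have -> : (fun w => (\sum_i x i w) ^+ 2) = (fun w => \sum_i \sum_j x i w * x j w).
  by apply/funext => w; rewrite expr2 big_distrlr.
rewrite Exsum; apply: (@le_trans _ _ (\sum_i p * prob (h i))).
  apply: ler_sum => i _; rewrite Exsum (bigD1 i) //= big1 ?addr0 // => j ij.
  by rewrite xx // eq_sym.
rewrite -big_distrr /=; apply: ler_wpM2l => //.
under eq_bigr do rewrite pH.
rewrite -Exsum -[leRHS]mulr1 -[X in _ <= B * X]Ex1 -ExZ; apply: Exle => t /=.
rewrite mulr1 (eq_bigr (fun i => (h i t)%:R)) ?hB // => i _.
by rewrite /H ffunE.
Qed.

End SecondMoment.

Lemma uniform_prob_le {R : realType} (p : R) : 0 <= p <= 1 ->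
  uniform_prob (@ltr01 R) [set r | r <= p] = p%:E.
Proof.
move=> /andP[p0 p1]; rewrite /uniform_prob integral_uniform_pdf.
have -> : [set r | r <= p] `&` `[0, 1]%classic = `[0, p]%classic.
  apply/seteqP; split => r /=; rewrite !in_itv /=.
    by move=> [-> /andP[-> _]].
  by move=> /andP[-> rp]; rewrite rp (le_trans rp).
rewrite (eq_integral (fun=> 1%E)); last first.
  move=> r; rewrite inE /= in_itv /= => /andP[r0 rp].
  by rewrite /uniform_pdf r0 (le_trans rp) // subr0 invr1.
rewrite integral_cst //= lebesgue_measure_itv /= lte_fin mul1e.
case: ltP => [_|p_le]; first by rewrite -EFinB subr0.
by congr EFin; apply/le_anti; rewrite p0 p_le.
Qed.

Lemma sigma_algebra_of_measurable {R : realType} {d : measure_display}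
    {T : measurableType d} (P : probability T R) {J : Type} (Y : J -> {RV P >-> R}) :
  sigma_algebra_of (fun j => Y j : T -> R) `<=` measurable.
Proof.
apply: smallest_sub => [|_ [e [A mA ->]]]; first exact: sigma_algebra_measurable.
by rewrite -[X in measurable X]setTI; exact: measurable_funP.
Qed.

(** * Deviations along Prim's algorithm *)

Section DeviationTail.
Context {R : realType} {d : measure_display} {T : measurableType d}.
Variable P : probability T R.
Context {nb nw : nat}.
Variable U : edge nb nw -> {RV P >-> R}.
Hypothesis iidU : iid_uniform U.
Let W t : edge nb nw -> R := fun e => U e t.
Implicit Types (x : vertex nb nw) (e : edge nb nw) (c : bool) (m : nat) (p : R).

Lemma measurable_weights (p : R) (F : T -> bool) :
  (forall t t', (forall e f, (W t e <= W t f) = (W t' e <= W t' f)) ->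
     (forall e, (W t e <= p) = (W t' e <= p)) -> F t = F t') ->
  sigma_algebra_of (fun e => U e : T -> R) [set t | F t].
Proof. exact: pattern_sigma_algebra. Qed.

(** The hypothesis places [F] in the sigma-algebra of the other weights, whence independence of the
    weight of [e]. One implication suffices, since [t] and [t'] may be exchanged. *)
Lemma prob_small (p : R) e (F : T -> bool) : 0 <= p <= 1 ->
  (forall t t', (forall f g, f != e -> g != e ->
       (W t f <= W t g) = (W t' f <= W t' g)) ->
     (forall f, f != e -> (W t f <= p) = (W t' f <= p)) -> F t -> F t') ->
  prob P (fun t => (W t e <= p) && F t) = p * prob P F.
Proof.
move=> p01 hF; have [unif ind] := iidU.
have mle : measurable [set r : R | r <= p].
  by rewrite -[X in measurable X]setTI; exact: measurable_fun_le.
have sF : sigma_algebra_of (fun f : {f | f != e} => U (val f) : T -> R) [set t | F t].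
  apply: (@pattern_sigma_algebra _ _ _ _ _ p) => t t' cmp thr.
  have fwd s s' : (forall f g : {f | f != e}, (U (val f) s <= U (val g) s) =
        (U (val f) s' <= U (val g) s')) ->
      (forall f : {f | f != e}, (U (val f) s <= p) = (U (val f) s' <= p)) -> F s -> F s'.
    move=> cmp' thr'; apply: hF => [f g fe ge|f fe].
      exact: (cmp' (exist _ f fe) (exist _ g ge)).
    exact: (thr' (exist _ f fe)).
  by apply/idP/idP; apply: fwd.
have mF : measurable [set t | F t].
  exact: (@sigma_algebra_of_measurable _ _ _ P _ (fun f : {f | f != e} => U (val f))).
have := independent_of_others ind mle sF.
rewrite /prob; have -> : [set t | (W t e <= p) && F t] =
    U e @^-1` [set r | r <= p] `&` [set t | F t].
  by apply/seteqP; split => t /= => [/andP[]|[-> ->]].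
move=> ->; have := unif e _ mle; rewrite uniform_prob_le //.
by rewrite /distribution /pushforward => ->; rewrite fineM // fin_num_measure.
Qed.

Lemma measurable_run (p : R) x m
    (phi : seq (vertex nb nw) -> pred (edge nb nw) -> bool) :
  measurable [set t | phi (prim (W t) x m) (small p (W t))].
Proof.
apply: sigma_algebra_of_measurable.
apply: (@measurable_weights p) => t t' cmp thr.
rewrite (eq_prim _ _ cmp); congr phi.
by apply/funext => e; exact: thr.
Qed.

Lemma prob_split (F G : T -> bool) :
  measurable [set t | F t && G t] -> measurable [set t | F t && ~~ G t] ->
  prob P F = prob P (fun t => F t && G t) + prob P (fun t => F t && ~~ G t).
Proof.
move=> mF mG; rewrite /prob -fineD ?fin_num_measure // -measureU //.
  congr (fine (P _)); apply/seteqP; split => t /=.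
    by move=> ->; case: (G t); [left|right].
  by move=> [/andP[]|/andP[]].
by apply/seteqP; split => // t /= [/andP[_ ->]] /andP[_].
Qed.

(** The deviation is the sum over all edges of the centred indicator of weight at most [p] times
    that of freshness. Of two fresh edges the later one has a status independent of the rest, so the
    terms are uncorrelated. *)
Lemma deviation_tail c (p : R) x m (r : R) : 0 <= p <= 1 -> 0 < r ->
  prob P (fun t => r < `|deviation c p (W t) x m|)
  <= p * (m * colour_size nb nw (~~ c))%:R / r ^+ 2.
Proof.
move=> p01 r0; have /andP[p0 p1] := p01.
pose s t := prim (W t) x m; pose A t := small p (W t).
pose h e t := fresh c (A t) (s t) e.
pose idx e t := index (endpoint c e) (s t).
have -> : (fun t => r < `|deviation c p (W t) x m|) =
    (fun t => r < `|\sum_e ((A t e)%:R - p) * (h e t)%:R|).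
  apply/funext => t; congr (_ < `| _ |); rewrite /deviation.
  under eq_bigr do rewrite mulrBl.
  rewrite sumrB -big_distrr /=; congr (_ - _ * _).
    rewrite -sum1_card natr_sum big_mkcond; apply: eq_bigr => e _.
    by rewrite inE /h -/(A t) -/(s t); case: (A t e) (fresh _ _ _ e) => [] []; rewrite ?mulr0 ?mul1r ?mul0r.
  rewrite -sum1_card natr_sum big_mkcond; apply: eq_bigr => e _.
  by rewrite inE /h -/(A t) -/(s t); case: (fresh _ _ _ e).
(* The status of e' is independent of everything seen up to the time when e'
   is uncovered. *)
have prob_late e e' (cmp : rel nat) (F : T -> bool) : (forall k l, cmp k l -> (k <= l)%N) ->
    (forall t t', (forall f, f != e' -> A t f = A t' f) -> F t = F t') ->
    prob P (fun t => A t e' && (F t && [&& h e t, h e' t & cmp (idx e t) (idx e' t)]))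
    = p * prob P (fun t => F t && [&& h e t, h e' t & cmp (idx e t) (idx e' t)]).
  move=> cmp_le hF; apply: prob_small => // t t' wcmp thr /and4P[Ft he he' ee'].
  have [f1 f2 i1 i2] := fresh_coupling wcmp thr he he' (cmp_le _ _ ee').
  rewrite -(hF _ _ thr) Ft /h -/(A t') -/(s t') f1 f2 /=.
  by rewrite /idx /s i1 i2.
have mrun (phi : seq (vertex nb nw) -> pred (edge nb nw) -> bool) :
    measurable [set t | phi (s t) (A t)] by exact: (measurable_run p x m phi).
apply: second_moment_tail => //.
- by move=> e; exact: (mrun (fun _ A => A e)).
- by move=> e; exact: (mrun (fun s A => fresh c A s e)).
- move=> e; have := prob_late e e leq xpredT (fun _ _ => id) (fun _ _ _ => erefl).
  have -> : (fun t => xpredT t && [&& h e t, h e t & (idx e t <= idx e t)%N]) = h e.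
    by apply/funext => t; rewrite leqnn andbT andbb.
  under [X in prob P X = _ -> _]funext => t do rewrite leqnn andbT andbb /=.
  by [].
- move=> e e' ee'.
  pose ord := fun t => (idx e t <= idx e' t)%N.
  (* Split by the order of uncovering; two edges uncovered at the same vertex fall into the first
     case, where [e'] counts as the later one. *)
  have split phi : prob P (fun t => phi (A t) && (h e t && h e' t)) =
      prob P (fun t => phi (A t) && [&& h e t, h e' t & (idx e t <= idx e' t)%N])
      + prob P (fun t => phi (A t) && [&& h e' t, h e t & (idx e' t < idx e t)%N]).
    rewrite (@prob_split _ ord).
    + congr (_ + _); congr prob; apply/funext => t; rewrite /ord.
        by rewrite -!andbA.
      by rewrite -ltnNge; case: (phi _); case: (h e t); case: (h e' t).
    + exact: (mrun (fun s A => (phi A && (fresh c A s e && fresh c A s e')) &&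
        (index (endpoint c e) s <= index (endpoint c e') s)%N)).
    + exact: (mrun (fun s A => (phi A && (fresh c A s e && fresh c A s e')) &&
        ~~ (index (endpoint c e) s <= index (endpoint c e') s)%N)).
  have e'e : e' != e by rewrite eq_sym.
  (* [T1] and [T2] extract the factor [p] for [e'] where it is the later edge, [T3] and [T4] for
     [e]; then all terms cancel. *)
  have T1 := prob_late e e' leq (fun t => A t e) (fun _ _ => id)
    (fun t t' H => H e ee').
  have T2 := prob_late e e' leq xpredT (fun _ _ => id) (fun _ _ _ => erefl).
  have T3 := prob_late e' e ltn (fun t => A t e') (fun _ _ => @ltnW _ _)
    (fun t t' H => H e' e'e).
  have T4 := prob_late e' e ltn xpredT (fun _ _ => @ltnW _ _) (fun _ _ _ => erefl).
  have S0 : prob P (fun t => h e t && h e' t) = _ := split xpredT.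
  have -> : (fun t => [&& A t e, A t e' & h e t && h e' t]) =
      (fun t => (A t e && A t e') && (h e t && h e' t)).
    by apply/funext => t; rewrite andbA.
  rewrite (split (fun A => A e && A e')) (split (fun A => A e)) (split (fun A => A e')).
  rewrite S0 T2 T4.
  have -> : prob P (fun t => (A t e && A t e') &&
      [&& h e t, h e' t & (idx e t <= idx e' t)%N]) =
      p * prob P (fun t => A t e && [&& h e t, h e' t & (idx e t <= idx e' t)%N]).
    by rewrite -T1; congr prob; apply/funext => t; case: (A t e); case: (A t e').
  have -> : prob P (fun t => (A t e && A t e') &&
      [&& h e' t, h e t & (idx e' t < idx e t)%N]) =
      p * prob P (fun t => A t e' && [&& h e' t, h e t & (idx e' t < idx e t)%N]).
    by rewrite -T3; congr prob; apply/funext => t; case: (A t e); case: (A t e').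
  by ring.
- move=> t.
  have -> : \sum_e (h e t)%:R = #|exposed c (A t) (s t)|%:R :> R.
    rewrite -sum1_card natr_sum [RHS]big_mkcond; apply: eq_bigr => e _.
    by rewrite inE -/(h e t); case: (h e t).
  rewrite ler_nat (leq_trans (card_exposed_le _ _ (prim_uniq _ _ _))) // leq_mul2r.
  apply/orP; right; apply: leq_trans (count_size _ _) _; exact: size_prim_le.
Qed.

End DeviationTail.

(** * Union bound and random starting vertex *)

Lemma prob_le_sum {R : realType} {d : measure_display} {T : measurableType d}
    (P : probability T R) {J : finType} (F : T -> bool) (G : J -> T -> bool) (B : R) :
  measurable [set t | F t] -> (forall j, measurable [set t | G j t]) ->
  (forall t, F t -> exists j, G j t) -> (forall j, prob P (G j) <= B) ->
  prob P F <= #|J|%:R * B.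
Proof.
move=> mF mG FG GB; apply: (@le_trans _ _ (\sum_j prob P (G j))); last first.
  apply: (@le_trans _ _ (\sum_(j : J) B)); first exact: ler_sum.
  by rewrite sumr_const mulr_natl.
rewrite -lee_fin /prob fineK ?fin_num_measure // -sumEFin.
under eq_bigr do rewrite fineK ?fin_num_measure //.
rewrite -(fsbig_finType _ xpredT); apply: content_sub_fsum => //.
by move=> t /FG [j Gj]; exists j.
Qed.

(** Condition on the start: it is independent of the weights, so a bound valid for every fixed start
    is preserved. *)
Lemma prob_start {R : realType} {d : measure_display} {T : measurableType d}
    (P : probability T R) {V : finType} {I : finType} (Y : T -> V) (X : I -> {RV P >-> R})
    (F : V -> T -> bool) (B : R) :
  uniform_element P Y -> independent_of P Y (fun i => X i : T -> R) ->
  (forall v, sigma_algebra_of (fun i => X i : T -> R) [set t | F v t]) ->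
  (forall v, prob P (F v) <= B) ->
  (P [set t | F (Y t) t] <= B%:E)%E.
Proof.
move=> unif ind sF FB.
have mF v : measurable [set t | F v t] by exact: sigma_algebra_of_measurable (sF v).
have -> : [set t | F (Y t) t] = \bigcup_(v in [set` xpredT]) (Y @^-1` [set v] `&` [set t | F v t]).
  by apply/seteqP; split => t /=; [exists (Y t)|move=> [v _ [<-]]].
rewrite measure_fin_bigcup //; last first.
- by move=> v _; apply: measurableI => //; case: (unif v).
- by move=> v w _ _ [t [[<- _] [<- _]]].
rewrite fsbig_finType.
apply: (@le_trans _ _ (\sum_(v : V) (#|V|%:R^-1 * B)%:E)%E).
  apply: lee_sum => v _; rewrite [leLHS](ind [set v] _ (sF v)) (unif v).2 EFinM.
  apply: lee_wpmul2l; first by rewrite lee_fin invr_ge0.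
  by have := FB v; rewrite -lee_fin /prob fineK ?fin_num_measure.
rewrite sumEFin lee_fin sumr_const -mulrnAl.
have [V0|V0] := eqVneq #|V| 0%N; last by rewrite -mulr_natr mulVf ?mul1r // pnatr_eq0.
have := @probability_setT _ _ _ P; rewrite (_ : setT = set0) ?measure0; last first.
  by apply/seteqP; split => // t _; have := fintype0 (Y t) V0.
by move=> /eqP; rewrite eqe eq_sym oner_eq0.
Qed.

(** Union bound over the two colours and the [(k %/ h).+2] grid times, each contributing at most
    [2 G k / (e^2 k)^2]. Outside these events the deterministic estimate applies. *)
Lemma rho_tail {R : realType} {d : measure_display} {T : measurableType d}
    (P : probability T R) (nb nw : nat) (U : edge nb nw -> {RV P >-> R})
    (start : T -> vertex nb nw) k h (p e g G c eps : R) :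
  iid_uniform U -> uniform_element P start ->
  independent_of P start (fun e => U e : T -> R) ->
  (0 < k <= nb + nw)%N -> (0 < nb)%N -> (0 < nw)%N -> (0 < h)%N ->
  0 < e <= 1 -> 0 < g <= G -> 0 < g^-1 <= G -> 1 <= G -> 0 <= p <= 1 ->
  p * nw%:R = (1 + e) * g -> p * nb%:R = (1 + e) * g^-1 ->
  h%:R <= e ^+ 2 * k%:R -> 1 <= e * k%:R ->
  p * k%:R * (2 + 2 * G) <= e ^+ 2 ->
  11 * G ^+ 4 * e + `|1 / (1 + g) - c| <= eps ->
  (P [set w | (eps < `|rho (fun e => U e w) (start w) k - c|)%R]
   <= ((2 * (k %/ h).+2)%:R * (2 * G / (e ^+ 4 * k%:R)))%R%:E)%E.
Proof.
move=> iid unif ind kn nb0 nw0 h0 e01 gG giG G1 p01 pw pb hk ek pk gc.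
have /andP[k0 _] := kn; have /andP[p0 _] := p01; have /andP[e0 e1] := e01.
pose F x w := eps < `|rho (fun e => U e w) x k - c|.
have sF x : sigma_algebra_of (fun e => U e : T -> R) [set w | F x w].
  apply: (@measurable_weights _ _ _ P _ _ U 0) => t t' cmp _.
  by rewrite /F /rho !card_Sigma_black (eq_prim _ _ cmp).
apply: (prob_start (F := F) unif ind sF) => x.
pose r := e ^+ 2 * k%:R.
have r0 : 0 < r by rewrite mulr_gt0 ?exprn_gt0 // ltr0n.
(* The last index times [h] exceeds [k], so truncation makes [k] itself a grid time. *)
pose m (i : 'I_(k %/ h).+2) := minn (i * h) k.
pose D (ci : bool * 'I_(k %/ h).+2) w := r < `|deviation ci.1 p (fun e => U e w) x (m ci.2)|.
have mD ci : measurable [set w | D ci w].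
  exact: (measurable_run U p x (m ci.2) (fun s A =>
    r < `|#|found ci.1 A s|%:R - p * #|exposed ci.1 A s|%:R|)).
have -> : (2 * (k %/ h).+2)%N = #|{: bool * 'I_(k %/ h).+2}|.
  by rewrite card_prod card_bool card_ord.
apply: (prob_le_sum (G := D)) => //; first exact: sigma_algebra_of_measurable (sF x).
  move=> w; apply: contraPP => /forallNP noD; apply/negP; rewrite -leNgt.
  apply: le_trans gc; apply: le_trans (ler_distD (1 / (1 + g)) _ _) _.
  rewrite lerD2r; apply: (@rho_near_critical _ _ _ _ _ _ h p) => // b j jk jh.
  rewrite leNgt; apply/negP => Dj.
  have [i ij] : exists i, m i = j.
    have [jE|jh'] := eqVneq j k.
      exists ord_max; rewrite /m jE; apply/minn_idPr => /=.
      by rewrite ltnW // ltn_ceil.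
    move: jh; rewrite (negbTE jh') /= => /dvdnP[i iE].
    have ik : (i < (k %/ h).+2)%N by rewrite ltnS leqW // leq_divRL // -iE.
    by exists (Ordinal ik); rewrite /m /= -iE; apply/minn_idPl.
  by apply: (noD (b, i)); rewrite /D /= ij.
move=> [b i]; have := deviation_tail iid b x (m i) p01 r0.
move=> /le_trans; apply.
rewrite natrM mulrCA.
have rate : p * (colour_size nb nw (~~ b))%:R <= 2 * G.
  have t z : 0 < z <= G -> (1 + e) * z <= 2 * G.
    by move=> /andP[z0 zG]; apply: ler_pM; lra.
  by case: (b); rewrite /= ?pw ?pb t.
have -> : 2 * G / (e ^+ 4 * k%:R) = k%:R * (2 * G) / r ^+ 2.
  by rewrite /r; field; rewrite !lt0r_neq0 // ltr0n.
rewrite ler_pM2r ?invr_gt0 ?exprn_gt0 //; apply: ler_pM => //.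
  by rewrite mulr_ge0.
by rewrite ler_nat geq_minr.
Qed.

(** * Limits *)

Lemma sqrt_ratio_eq {R : realType} (theta : R) : 0 < theta < 1 ->
  1 / (1 + gamma theta) =
    Num.sqrt theta / (Num.sqrt theta + Num.sqrt (1 - theta)).
Proof.
move=> /andP[t0 t1].
have s0 : 0 < Num.sqrt theta by rewrite sqrtr_gt0.
have s1 : 0 < Num.sqrt (1 - theta) by rewrite sqrtr_gt0 subr_gt0.
rewrite /gamma sqrtrM ?sqrtrV ?subr_ge0 ?ltW //.
by field; rewrite !gt_eqF ?addr_gt0 // divr_gt0.
Qed.

Lemma dist_inv_le {R : realType} (a b : R) : 0 < a -> 0 < b ->
  `|1 / (1 + a) - 1 / (1 + b)| <= `|a - b|.
Proof.
move=> a0 b0.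
have -> : 1 / (1 + a) - 1 / (1 + b) = (b - a) / ((1 + a) * (1 + b)).
  by field; rewrite !gt_eqF //; lra.
have d0 : 0 < (1 + a) * (1 + b) by rewrite mulr_gt0; lra.
rewrite normrM normfV (gtr0_norm d0) ler_pdivrMr // distrC ler_peMr //.
by have : 0 < a * b by [rewrite mulr_gt0]; rewrite mulrDl mulrDr; lra.
Qed.

Lemma sqrt_ratio_cvg {R : realType} (theta : R) (nb nw : nat -> nat) :
  (forall n, nb n + nw n = n)%N -> 0 < theta < 1 ->
  (nb n)%:R / n%:R @[n --> \oo] --> theta ->
  (nw n)%:R / n%:R @[n --> \oo] --> 1 - theta /\
  Num.sqrt ((nw n)%:R / (nb n)%:R) @[n --> \oo] --> gamma theta.
Proof.
move=> nbw /andP[t0 t1] cb.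
have cw : (nw n)%:R / n%:R @[n --> \oo] --> 1 - theta.
  have : 1 - (nb n)%:R / n%:R @[n --> \oo] --> 1 - theta.
    by apply: cvgB cb; exact: cvg_cst.
  apply: cvg_trans; apply: near_eq_cvg; exists 1%N => // n /= n0.
  have nn : n%:R != 0 :> R by rewrite pnatr_eq0 -lt0n.
  have : ((nb n)%:R + (nw n)%:R) / n%:R = 1 :> R by rewrite -natrD nbw divff.
  by rewrite mulrDl; lra.
split=> //; rewrite /gamma.
apply: (continuous_cvg _ (@sqrt_continuous R _)).
have : (nw n)%:R / n%:R * ((nb n)%:R / n%:R)^-1 @[n --> \oo] --> (1 - theta) * theta^-1.
  by apply: cvgM => //; apply: cvgV => //; rewrite gt_eqF.
apply: cvg_trans; apply: near_eq_cvg; exists 1%N => // n /= n0.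
have nn : n%:R != 0 :> R by rewrite pnatr_eq0 -lt0n.
by rewrite invf_div mulrA divfK.
Qed.

(** As [w >= s N], [p k] is at most of order [k / N], which tends to 0 in the application. The bound
    [p <= 1] follows from the one on [p k] because [1 <= k]. *)
Lemma edge_probability_bounds {R : realFieldType} (e g G s N k w : R) :
  0 < e <= 1 -> 0 < g <= G -> 1 <= G -> 0 < s -> 0 < N -> 0 < w -> 1 <= k ->
  k / N <= e ^+ 2 / (2 + 2 * G) * s / (2 * G) -> s <= w / N ->
  let p := (1 + e) * g / w in
  [/\ 0 <= p, p <= 1 & p * k * (2 + 2 * G) <= e ^+ 2].
Proof.
move=> /andP[e0 e1] /andP[g0 gG] G1 s0 N0 w0 k1 kz wN p.
have p0 : 0 <= p by rewrite divr_ge0 ?mulr_ge0 //; lra.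
have G2 : 0 < 2 + 2 * G by lra.
pose q := e ^+ 2 / (2 + 2 * G).
have q0 : 0 <= q by rewrite divr_ge0 ?sqr_ge0 // ltW.
have kw : k / w <= q / (2 * G).
  rewrite ler_pdivrMr //.
  move: kz wN; rewrite ler_pdivrMr // ler_pdivlMr // -/q => kz wN.
  apply: (le_trans kz).
  have -> : q * s / (2 * G) * N = q / (2 * G) * (s * N) by ring.
  by apply: ler_wpM2l => //; rewrite divr_ge0 //; lra.
have pkq : p * k <= q.
  have -> : p * k = (1 + e) * g * (k / w) by rewrite /p; ring.
  apply: (@le_trans _ _ (2 * G * (q / (2 * G)))).
    apply: ler_pM => //; first by rewrite mulr_ge0 //; lra.
      by rewrite divr_ge0 //; lra.
    by apply: ler_pM; lra.
  by rewrite mulrC divfK // gt_eqF //; lra.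
split=> //; last by rewrite -ler_pdivlMr.
apply: (@le_trans _ _ (p * k)); first by rewrite ler_peMr.
apply: (le_trans pkq); rewrite ler_pdivrMr // mul1r.
by have : e ^+ 2 <= 1; [rewrite expr_le1 // ltW|lra].
Qed.

(** With [h = k %/ L], [k < (h + 1) L <= 2 L h]. The number of grid times thus stays bounded as [k]
    grows, so the union bound costs only a constant factor. *)
Lemma grid_size k L : (0 < L <= k)%N -> (k %/ (k %/ L) <= 2 * L)%N.
Proof.
move=> /andP[L0 Lk]; have h0 : (0 < k %/ L)%N by rewrite divn_gt0.
rewrite -ltnS ltn_divLR //; apply: leq_trans (ltn_ceil k L0) _.
have := leq_pmulr L h0; move: (k %/ L)%N => h.
by rewrite !mulSn mul0n addn0 mulnDl [(h * L)%N]mulnC; lia.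
Qed.

(* The graphs are indexed by n >= 1: (T n, P n) carries the one on n.+1
   vertices. *)
Theorem theorem1 (R : realType) (theta : R) (nb nw kappa : nat -> nat)
  (d : nat -> measure_display) (T : forall n, measurableType (d n))
  (P : forall n, probability (T n) R)
  (U : forall n, edge (nb n.+1) (nw n.+1) -> {RV (P n) >-> R})
  (start : forall n, T n -> vertex (nb n.+1) (nw n.+1)) :
  (forall n, nb n + nw n = n)%N ->
  0 < theta < 1 ->
  (nb n)%:R / n%:R @[n --> \oo] --> theta ->
  (forall n, iid_uniform (U n)) ->
  (forall n, uniform_element (P n) (start n)) ->
  (forall n, independent_of (P n) (start n) (fun e => U n e : T n -> R)) ->
  (forall n, (0 < n)%N -> (0 < kappa n)%N) ->
  kappa n @[n --> \oo] --> \oo ->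
  (kappa n)%:R / n%:R @[n --> \oo] --> (0 : R) ->
  cvg_in_probability P
    (fun n w => rho (fun e => U n e w) (start n w) (kappa n.+1))
    (1 / (1 + gamma theta)) /\
  1 / (1 + gamma theta) =
    Num.sqrt theta / (Num.sqrt theta + Num.sqrt (1 - theta)).
Proof.
move=> nbw t01 cb iid unif ind k_gt0 k_oo ko.
split; last exact: sqrt_ratio_eq.
have [cw cg] := sqrt_ratio_cvg nbw t01 cb.
have /andP[t0 t1] := t01.
have gam0 : 0 < gamma theta by rewrite sqrtr_gt0 divr_gt0 ?subr_gt0.
move=> eps eps0.
pose ga := gamma theta; have ga0 : 0 < ga := gam0.
(* Bounds both [g] and [g^-1] once [ga / 2 <= g <= 2 ga]. *)
pose G : R := 1 + 2 * ga + 2 / ga.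
have gai0 : 0 < 2 / ga by rewrite divr_gt0.
have G1 : 1 <= G by rewrite /G; lra.
have G4 : 0 < 11 * G ^+ 4 by rewrite mulr_gt0 // exprn_gt0 //; lra.
(* Half of [eps] covers the deterministic error [11 G^4 e], the other half the passage from [g] to
   its limit [ga]. *)
pose e : R := Num.min 1 (eps / 2 / (11 * G ^+ 4)).
have e0 : 0 < e by rewrite lt_min ltr01 !divr_gt0.
have e1 : e <= 1 by rewrite ge_min lexx.
have e01 : 0 < e <= 1 by rewrite e0 e1.
have eG : 11 * G ^+ 4 * e <= eps / 2.
  by rewrite mulrC -ler_pdivlMr // ge_min lexx orbT.
(* The grid step will be [k %/ L], which [L >= e^-2] keeps at most [e^2 k]. *)
pose L := (Num.truncn (e ^- 2)).+1.
have eL : 1 <= e ^+ 2 * L%:R.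
  by rewrite -ler_pdivrMl ?exprn_gt0 // mulr1 ltW // truncnS_gt.
pose C : R := (2 * (2 * L).+2)%:R * (2 * G / e ^+ 4).
have C0 : 0 <= C.
  by apply: mulr_ge0 => //; apply: divr_ge0; [lra|exact/ltW/exprn_gt0].
(* The bound on [kappa n / n] required by [edge_probability_bounds] with [s = (1 - theta) / 2]. *)
pose z := e ^+ 2 / (2 + 2 * G) * ((1 - theta) / 2) / (2 * G).
have z0 : 0 < z.
  have G22 : 0 < 2 + 2 * G by lra.
  have G2 : 0 < 2 * G by lra.
  by rewrite divr_gt0 // mulr_gt0 ?divr_gt0 ?exprn_gt0 ?subr_gt0.
have shift (Q : nat -> Prop) : (\forall n \near \oo, Q n) -> \forall n \near \oo, Q n.+1.
  by move=> [M _ QM]; exists M => // n /= Mn; apply: QM; exact: leqW.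
have bound : \forall n \near \oo,
    (P n [set w | (eps < `|rho (fun e => U n e w) (start n w) (kappa n.+1)
       - 1 / (1 + gamma theta)|)%R] <= (C / (kappa n.+1)%:R)%R%:E)%E.
  have : \forall n \near \oo,
      [/\ (L <= kappa n)%N, (kappa n)%:R / n%:R <= z /\ (kappa n)%:R / n%:R <= 1 :> R,
        theta / 2 <= (nb n)%:R / n%:R, (1 - theta) / 2 <= (nw n)%:R / n%:R &
        `|ga - Num.sqrt ((nw n)%:R / (nb n)%:R)| <= Num.min (eps / 2) (ga / 2)].
    near=> n; split.
    - by near: n; move/cvgnyPge: k_oo; apply.
    - by split; near: n; apply: (cvgr_le _ ko).
    - by near: n; apply: (cvgr_ge _ cb); lra.
    - by near: n; apply: (cvgr_ge _ cw); lra.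
    - near: n; move/cvgrPdist_le: cg; apply.
      by rewrite lt_min !divr_gt0.
  move=> /shift; apply: filterS => n.
  set N := n.+1; set k := kappa N; set b := nb N; set w := nw N.
  move=> [Lk [kz k1] bN wN]; rewrite le_min => /andP[gd1 gd2].
  have N0 : 0 < N%:R :> R by rewrite ltr0n.
  have b0 : (0 < b)%N.
    rewrite -(ltr0n R) -(pmulr_lgt0 _ (_ : 0 < N%:R^-1)) ?invr_gt0 //.
    by apply: lt_le_trans bN; rewrite divr_gt0.
  have w0 : (0 < w)%N.
    rewrite -(ltr0n R) -(pmulr_lgt0 _ (_ : 0 < N%:R^-1)) ?invr_gt0 //.
    by apply: lt_le_trans wN; rewrite divr_gt0 // subr_gt0.
  have k0 : (0 < k)%N by exact: k_gt0.
  (* With this [g], the [p] below equals [(1 + e) / sqrt(b w)], slightly above the critical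
     value. *)
  pose g : R := Num.sqrt (w%:R / b%:R).
  have g0 : 0 < g by rewrite sqrtr_gt0 divr_gt0 ?ltr0n.
  have g2 : g ^+ 2 = w%:R / b%:R by rewrite sqr_sqrtr // divr_ge0.
  have [gl gu] : ga / 2 <= g /\ g <= 2 * ga.
    by move: gd2; rewrite -/g ler_norml => /andP[]; lra.
  have gG : g <= G by rewrite /G; lra.
  have giG : g^-1 <= G.
    apply: (@le_trans _ _ (2 / ga)); last by rewrite /G; lra.
    by rewrite -[2 / ga]invrK invf_div lef_pV2 // posrE ?divr_gt0.
  have w0' : 0 < w%:R :> R by rewrite ltr0n.
  have b0' : 0 < b%:R :> R by rewrite ltr0n.
  have gG0 : 0 < g <= G by rewrite g0 gG.
  pose p : R := (1 + e) * g / w%:R.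
  have k1' : 1 <= k%:R :> R by rewrite ler1n.
  have s0 : 0 < (1 - theta) / 2 by rewrite divr_gt0 // subr_gt0.
  have [p0 p1 pk] := edge_probability_bounds e01 gG0 G1 s0 N0 w0' k1' kz wN.
  pose h := (k %/ L)%N.
  have h0 : (0 < h)%N by rewrite divn_gt0.
  apply: (@le_trans _ _ ((2 * (k %/ h).+2)%:R * (2 * G / (e ^+ 4 * k%:R)))%R%:E).
    apply: (@rho_tail _ _ _ _ _ _ _ _ _ _ p e g G) => //.
    - rewrite k0 nbw -(ler_nat R) /=.
      by move: k1; rewrite ler_pdivrMr // mul1r.
    - by rewrite invr_gt0 g0 giG.
    - by rewrite p0 p1.
    - by rewrite /p divfK // gt_eqF.
    - rewrite /p; have -> : w%:R = g ^+ 2 * b%:R :> R by rewrite g2 divfK // gt_eqF.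
      by field; rewrite !gt_eqF.
    - apply: (@le_trans _ _ (e ^+ 2 * L%:R * h%:R)).
        by rewrite ler_peMl.
      by rewrite -mulrA ler_pM2l ?exprn_gt0 // -natrM ler_nat mulnC leq_divM.
    - apply: le_trans eL _; rewrite expr2 -mulrA ler_pM2l //.
      apply: (@le_trans _ _ L%:R); last by rewrite ler_nat.
      by rewrite ler_piMl.
    - rewrite [leRHS]splitr; apply: lerD => //.
      apply: le_trans (dist_inv_le g0 gam0) _.
      by rewrite distrC.
  rewrite lee_fin /C invfM -!mulrA; apply: ler_pM => //.
    rewrite mulr_ge0 // mulr_ge0; [by []|exact: le_trans G1|].
    by rewrite mulr_ge0 ?invr_ge0 ?exprn_ge0 // ltW.
  by rewrite ler_nat leq_mul2l /= !ltnS grid_size.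
(* The probabilities are eventually at most [C / kappa], with [C] independent of the index, and
   [kappa] tends to infinity. *)
apply/fine_cvgP; split.
  apply: filterS bound => n Pn.
  by rewrite ge0_fin_numE // (le_lt_trans Pn) // ltry.
apply/cvgrPdist_le => e' e'0; near=> n.
rewrite sub0r normrN ger0_norm ?fine_ge0 //=.
have Pn : (P n [set w | (eps < `|rho (fun e => U n e w) (start n w) (kappa n.+1)
       - 1 / (1 + gamma theta)|)%R] <= (C / (kappa n.+1)%:R)%R%:E)%E by near: n.
have kn : C / e' <= (kappa n.+1)%:R.
  near: n; apply: (shift (fun n => C / e' <= (kappa n)%:R)).
  have : \forall n \near \oo, ((Num.truncn (C / e')).+1 <= kappa n)%N.
    by move/cvgnyPge: k_oo; apply.
  apply: filterS => n kn; apply: (@le_trans _ _ (Num.truncn (C / e')).+1%:R).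
    by rewrite ltW // truncnS_gt.
  by rewrite ler_nat.
rewrite -lee_fin fineK; last by rewrite ge0_fin_numE // (le_lt_trans Pn) // ltry.
apply: (le_trans Pn); rewrite lee_fin ler_pdivrMr ?ltr0n ?k_gt0 //.
by rewrite mulrC -ler_pdivrMr.
Unshelve. all: by end_near.
Qed.
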